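(* Let $A:\operatorname{D}(A)\to\mathcal H$ be a self-adjoint operator on a Hilbert space $\mathcal H$, let $\mathcal L\subset \operatorname{D}(A)$ be a subspace of finite dimension $n$, let $t\in\mathbb R$ and let $m\le n$ be such that $[t-\mathfrak d_m(t),t+\mathfrak d_m(t)]\cap\sigma(A)\subseteq\sigma_{\mathrm{disc}}(A)$. Let $\{u_j^t\}_{j=1}^n\subset\mathcal L$ be an orthonormal family of eigenfunctions associated to the eigenvalues $\mu=F^j_{\mathcal L}(t)$, $j=1,\dots,n$, of the weak problem: find $(\mu,u)\in[0,\infty)\times(\mathcal L\setminus\{0\})$ such that $\langle (A-t)u,(A-t)v\rangle=\mu^2\langle u,v\rangle$ for all $v\in\mathcal L$. Assume that, for $j\in\{1,\dots,m\}$, $F_{\mathcal L}^j(t)-\mathfrak d_j(t)$ is small enough so that $0<\varepsilon_j<1$ holds true for the residuals constructed inductively as $$\varepsilon_1=\sqrt{\frac{F_{\mathcal L}^1(t)^2-\mathfrak d_1(t)^2}{\delta_1(t)^2-\mathfrak d_1(t)^2}},$$ $$\varepsilon_j=\sqrt{\frac{F^j_{\mathcal L}(t)^2-\mathfrak d_j(t)^2}{\delta_j(t)^2-\mathfrak d_j(t)^2}+\sum_{k=1}^{j-1}\frac{\varepsilon^2_k}{1-\varepsilon_k^2}\left(1+\frac{\mathfrak d_j(t)^2-\mathfrak d_k(t)^2}{\delta_j(t)^2-\mathfrak d_j(t)^2}\right)}.$$ Then there exists an orthonormal set $\{\phi_j^t\}_{j=1}^m$ in $\mathcal E_{[t-\mathfrak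 d_m(t),t+\mathfrak d_m(t)]}(A)$ such that, for every $j\in\{1,\dots,m\}$, $\phi_j^t\in\mathcal E_{\{t-\mathfrak d_j(t),\,t+\mathfrak d_j(t)\}}(A)$, $$\|u_j^t-\langle u_j^t,\phi_j^t\rangle \phi_j^{t}\|\leq \varepsilon_j\qquad\text{and}\qquad |u_j^t-\langle u_j^t,\phi_j^t\rangle \phi_j^t|_t \leq\sqrt{F^j_{\mathcal L}(t)^2-\mathfrak d_j(t)^2+ \mathfrak d_j(t)^2\varepsilon_j^2}.$$
   Context: $\sigma_{\mathrm{disc}}(A)$ is the discrete spectrum of $A$ (isolated eigenvalues of finite multiplicity). For $u\in\operatorname{D}(A)$, $|u|_t=\|(A-t)u\|$. Define $$\mathfrak d_j(t)=\inf_{\substack{\dim V=j\\ V\subset\operatorname{D}(A)}}\ \sup_{0\ne u\in V}\frac{|u|_t}{\|u\|},\qquad F_{\mathcal L}^j(t)=\min_{\substack{\dim V=j\\ V\subset\mathcal L}}\ \max_{0\ne u\in V}\frac{|u|_t}{\|u\|}\quad(1\le j\le n).$$ The numbers $F_{\mathcal L}^1(t)\le\dots\le F_{\mathcal L}^n(t)$ are exactly the eigenvalues $\mu$, counted with multiplicity, of the weak problem in the claim. For a set $I\subset\mathbb R$, $\mathcal E_I(A)=\bigoplus_{\lambda\in I}\ker(A-\lambda)$. For $1\le j\le m$, $$\delta_j(t)=\operatorname{dist}\bigl[t,\ \sigma(A)\setminus\{t\pm\mathfrak d_k(t)\}_{k=1}^j\bigr]$$ (with $\delta_j(t)=+\infty$,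 and quotients by $\delta_j(t)^2-\mathfrak d_j(t)^2$ equal to $0$, if this set is empty). Under the hypothesis on $m$, $\delta_j(t)>\mathfrak d_j(t)$ for all $j\le m$. *)

(* Defs.v *)
From HB Require Import structures.
From mathcomp Require Export all_boot all_order all_algebra.
From mathcomp Require Export all_classical all_reals all_analysis.
From mathcomp Require Export sesquilinear complex.

Export Order.TTheory GRing.Theory Num.Theory.
Export numFieldNormedType.Exports.

Set Implicit Arguments.
Unset Strict Implicit.
Unset Printing Implicit Defensive.

Local Open Scope classical_set_scope.
Local Open Scope complex_scope.
Local Open Scope ring_scope.

(* A complex Hilbert space is a complete normed space H over R[i] with a
   positive definite Hermitian form dot (linear in its first argument,
   conjugate-linear in its second one) that induces the norm. *)
Definition norm_induced_by (R : realType) (H : normedModType R[i])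
    (dot : {dot H for Num.conj}) : Prop :=
  forall u : H, dot u u = `|u| ^+ 2.

(* The library norms on H and on R[i] take values in R[i]; they are real. *)
Definition rnorm (R : realType) (V : normedModType R[i]) (u : V) : R :=
  complex.Re `|u|.

Definition orthonormal_family (R : realType) (H : normedModType R[i])
    (dot : {dot H for Num.conj}) (k : nat) (v : 'I_k -> H) : Prop :=
  forall i j, dot (v i) (v j) = (i == j)%:R.

Section FiniteDimension.
Variables (R : realType) (H : normedModType R[i]).

Definition lin_indep (k : nat) (v : 'I_k -> H) : Prop :=
  forall c : 'I_k -> R[i], \sum_(i < k) c i *: v i = 0 -> forall i, c i = 0.

Definition lin_span (k : nat) (v : 'I_k -> H) : set H :=
  [set w | exists c : 'I_k -> R[i], w = \sum_(i < k) c i *: v i].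

Definition has_dim (V : set H) (k : nat) : Prop :=
  exists2 v : 'I_k -> H, lin_indep v & V = lin_span v.

End FiniteDimension.

(* The values of opfun outside the domain dom are irrelevant. *)
Record operator (R : realType) (H : normedModType R[i]) := Operator {
  dom : set H;
  opfun :> H -> H;
  dom0 : dom 0;
  dom_lin : forall (a : R[i]) u v, dom u -> dom v -> dom (a *: u + v);
  opfun_lin : forall (a : R[i]) u v, dom u -> dom v ->
    opfun (a *: u + v) = a *: opfun u + opfun v
}.

Section Operators.
Variables (R : realType) (H : normedModType R[i]).
Implicit Types (A : operator H) (t : R) (z : R[i]) (j : nat).

(* A is densely defined and its graph is that of its adjoint. *)
Definition selfadjoint (dot : {dot H for Num.conj}) A : Prop :=
  dense (dom A) /\
  forall v w : H, (dom A v /\ A v = w) <->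
                  (forall u, dom A u -> dot (A u) v = dot u w).

Definition resolvent_set A : set R[i] :=
  [set z | (forall w, exists! u, dom A u /\ A u - z *: u = w) /\
           (exists c : R, forall u, dom A u ->
              rnorm u <= c * rnorm (A u - z *: u))].

Definition spectrum A : set R[i] := ~` resolvent_set A.

Definition eigenspace A z : set H := [set u | dom A u /\ A u = z *: u].

(* The regular module (R[i])^o carries the usual topology of the plane. *)
Definition disc_spectrum A : set R[i] :=
  [set z | isolated (spectrum A : set (R[i])^o) z /\
           exists2 k, (0 < k)%N & has_dim (eigenspace A z) k].

(* Direct sums are algebraic: only finitely many summands are nonzero. *)
Definition eigensum A (I : set R) : set H :=
  [set u | exists k (l : 'I_k -> R) (v : 'I_k -> H),
     (forall i, I (l i) /\ eigenspace A (l i)%:C (v i)) /\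
     u = \sum_(i < k) v i].

Definition seminorm A t (u : H) : R := rnorm (A u - t%:C *: u).

(* For 0 < j and W a subspace of dom A of dimension at least j, the suprema
   are over nonempty bounded sets, the infimum is over a nonempty set bounded
   below by 0, and, when W is finite-dimensional, both are attained. *)
Definition minimax A t (W : set H) j : R :=
  inf [set sup [set seminorm A t u / rnorm u | u in V `\ 0] |
       V in [set V : set H | has_dim V j /\ V `<=` W]].

Definition specdist A t j : R := minimax A t (dom A) j.

(* Distances are in \bar R, so that the distance to the empty set is +oo. *)
Definition specgap A t j : \bar R :=
  ereal_inf [set (rnorm (z - t%:C : (R[i])^o))%:E | z in
    spectrum A `\`
    [set z | exists2 k, (0 < k <= j)%N &
       z = (t + specdist A t k)%:C \/ z = (t - specdist A t k)%:C]].

(* The quotient x / (specgap ^ 2 - specdist ^ 2); it is 0 if specgap = +oo. *)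
Definition gapquot A t j (x : R) : R :=
  fine (x%:E / (specgap A t j ^+ 2 - (specdist A t j ^+ 2)%:E))%E.

Definition weak_eigenpair (dot : {dot H for Num.conj}) A (L : set H) t
    (mu : R) (u : H) : Prop :=
  [/\ 0 <= mu, L u, u != 0 &
      forall v, L v ->
        dot (A u - t%:C *: u) (A v - t%:C *: v) = (mu ^+ 2)%:C * dot u v].

End Operators.

(* Main.v *)
Require Import Defs.
From mathcomp Require Import ring lra.

Set Implicit Arguments.
Unset Strict Implicit.
Unset Printing Implicit Defensive.
Import ComplexField.Normc.

Local Open Scope classical_set_scope.
Local Open Scope complex_scope.
Local Open Scope ring_scope.

(** Write B = A - t, d_j for the min-max number specdist A t j and delta_j for
    specgap A t j.  The vectors phi_1, ..., phi_m are built one after the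
    other: once phi_1, ..., phi_(j-1) are known, split

      u_j = s + w + y,

    where s is the component of u_j in the span of the earlier phi_k, y is the
    component of u_j - s in the eigenspaces of A at t + d_j and t - d_j, and
    phi_j is y normalized ([splitting], [next_vector]).  The three parts are
    orthogonal, and so are their images under B, because B ^ 2 acts as a scalar
    on each phi_k and on y.  With the squared residual N = |s| ^ 2 + |w| ^ 2
    and F = |B u_j|, this gives

      1 = N + |y| ^ 2,     F ^ 2 = |B s| ^ 2 + |B w| ^ 2 + d_j ^ 2 |y| ^ 2.

    The remainder w is orthogonal to all the eigenspaces at t + d_k and t - d_k
    with k <= j, so |B w| >= delta_j |w|, and the two identities bound N by
    (F ^ 2 - d_j ^ 2) / (delta_j ^ 2 - d_j ^ 2) plus the sum of
    |<u_j, phi_k>| ^ 2 (1 + (d_j ^ 2 - d_k ^ 2) / (delta_j ^ 2 - d_j ^ 2)) over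
    k < j.  As u_j is orthogonal to u_k, which is a multiple of phi_k up to
    eps_k, each |<u_j, phi_k>| ^ 2 is at most eps_k ^ 2 / (1 - eps_k ^ 2); so N
    is at most eps_j ^ 2, and y is nonzero because eps_j < 1.  The estimate in
    the seminorm is then |B (s + w)| ^ 2 = F ^ 2 - d_j ^ 2 (1 - N).

    What this uses of the spectrum has direct proofs that do not go through
    the spectral theorem.
    - Lower bounds ([regular_gap]).  Let M be the orthogonal complement of a set
      of eigenvectors, and c the best constant with |B u| >= c |u| on M.  The
      form |B u| ^ 2 - c ^ 2 |u| ^ 2 is nonnegative on M.  If B - c and B + c
      were both invertible on M, Cauchy-Schwarz for this form, applied to u and
      to a preimage of u under (B - c) (B + c), would improve c.
    - Isolated points ([punctured_split]).  If the real numbers around mu, mu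
      excepted, are in the resolvent set, the contraction
      V = (1 - r (A - mu - r) ^-1) / 2 fixes exactly ker (A - mu), and the lower
      bounds at mu + r and mu - r put a gap below 1 in its spectrum.  The
      iterates of V then converge to the projection onto ker (A - mu), and
      A - mu is bounded below on the orthogonal complement.
    - Exhaustion ([sq_eigen_exhausted]).  The span of the earlier phi_k contains
      every eigenvector whose eigenvalue is at distance less than d_j from t:
      otherwise it would extend some phi_1, ..., phi_l to a test space that
      makes d_(l+1) too small.  This yields d_j < delta_j
      ([specdist_lt_specgap]) as well as the orthogonality of w to the
      eigenspaces at t + d_k and t - d_k with d_k < d_j. *)

(** * Real norms and the inner product *)

Section RealNorm.
Variables (R : realType) (V : normedModType R[i]).
Implicit Types (u v w : V) (z : R[i]) (a : R).

Lemma rnormE u : `|u| = (rnorm u)%:C.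
Proof. by rewrite /rnorm RRe_real// normr_real. Qed.

Lemma rnorm_ge0 u : 0 <= rnorm u.
Proof. by rewrite -ler0c -rnormE. Qed.

Lemma rnorm0 : rnorm (0 : V) = 0.
Proof. by rewrite /rnorm normr0. Qed.

Lemma rnorm_eq0 u : (rnorm u == 0) = (u == 0).
Proof. by rewrite -(normr_eq0 u) rnormE; apply/eqP/eqP => [->|[]]. Qed.

Lemma rnorm_gt0 u : (0 < rnorm u) = (u != 0).
Proof. by rewrite lt_neqAle rnorm_ge0 andbT eq_sym rnorm_eq0. Qed.

Lemma rnormN u : rnorm (- u) = rnorm u.
Proof. by rewrite /rnorm normrN. Qed.

Lemma rnormC u v : rnorm (u - v) = rnorm (v - u).
Proof. by rewrite -rnormN opprB. Qed.

Lemma rnormD u v : rnorm (u + v) <= rnorm u + rnorm v.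
Proof. by rewrite -lecR rmorphD/= -!rnormE ler_normD. Qed.

Lemma rnormZ z u : rnorm (z *: u) = normc z * rnorm u.
Proof.
apply: complexI; rewrite -rnormE normrZ rnormE rmorphM/=; congr (_ * _).
Qed.

Lemma normc_ge0 z : 0 <= normc z.
Proof. by case: z => a b; rewrite /= sqrtr_ge0. Qed.

Lemma normcR a : normc a%:C = `|a|.
Proof. by rewrite /= expr0n /= addr0 sqrtr_sqr. Qed.

Lemma normcsq z : normc z ^+ 2 = complex.Re z ^+ 2 + complex.Im z ^+ 2.
Proof. by case: z => a b /=; rewrite sqr_sqrtr// addr_ge0 ?sqr_ge0. Qed.

Lemma rnorm_complex z : rnorm (z : (R[i])^o) = normc z.
Proof. by []. Qed.

End RealNorm.

Section InnerProduct.
Variables (R : realType) (H : normedModType R[i]) (dot : {dot H for Num.conj}).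
Hypothesis hdot : norm_induced_by dot.
Implicit Types (u v w : H) (z : R[i]) (a : R).

(** The real part of dot.  The operators inverted below are shifts of A by real
    numbers, so estimates can be made in the underlying real Hilbert space,
    where the form is symmetric and linear arithmetic applies. *)
Definition ip u v : R := complex.Re (dot u v).

Lemma dotDl u v w : dot (u + v) w = dot u w + dot v w.
Proof. exact: linearDl. Qed.
Lemma dotDr u v w : dot u (v + w) = dot u v + dot u w.
Proof. exact: linearDr. Qed.
Lemma dotBl u v w : dot (u - v) w = dot u w - dot v w.
Proof. exact: linearBl. Qed.
Lemma dotBr u v w : dot u (v - w) = dot u v - dot u w.
Proof. exact: linearBr. Qed.
Lemma dotNl u w : dot (- u) w = - dot u w.
Proof. exact: linearNl. Qed.
Lemma dotZl z u w : dot (z *: u) w = z * dot u w.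
Proof. exact: linearZl_LR. Qed.
Lemma dotZr z u w : dot u (z *: w) = z^* * dot u w.
Proof. exact: linearZr_LR. Qed.
Lemma dot0l u : dot 0 u = 0.
Proof. exact: linear0l. Qed.
Lemma dot0r u : dot u 0 = 0.
Proof. exact: linear0r. Qed.
Lemma dot_suml n (f : 'I_n -> H) u (P : pred 'I_n) :
  dot (\sum_(i | P i) f i) u = \sum_(i | P i) dot (f i) u.
Proof. exact: linear_sumlz. Qed.
Lemma dotC u v : dot u v = (dot v u)^*.
Proof. by rewrite hermC expr0 mul1r. Qed.

Lemma dot_eq0C u v : dot u v = 0 -> dot v u = 0.
Proof. by rewrite dotC => /eqP; rewrite conjc_eq0 => /eqP. Qed.

Lemma ipC u v : ip u v = ip v u.
Proof. by rewrite /ip dotC; case: (dot v u). Qed.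

Lemma ipDl u v w : ip (u + v) w = ip u w + ip v w.
Proof. by rewrite /ip dotDl; case: (dot u w); case: (dot v w). Qed.
Lemma ipDr u v w : ip u (v + w) = ip u v + ip u w.
Proof. by rewrite ipC ipDl !(ipC u). Qed.
Lemma ipNl u w : ip (- u) w = - ip u w.
Proof. by rewrite /ip dotNl; case: (dot u w). Qed.
Lemma ipNr u w : ip u (- w) = - ip u w.
Proof. by rewrite ipC ipNl ipC. Qed.
Lemma ipZl a u w : ip (a%:C *: u) w = a * ip u w.
Proof. by rewrite /ip dotZl; case: (dot u w) => x y /=; rewrite mul0r subr0. Qed.
Lemma ipZr a u w : ip u (a%:C *: w) = a * ip u w.
Proof. by rewrite ipC ipZl ipC. Qed.

Definition ipE := (ipDl, ipDr, ipNl, ipNr, ipZl, ipZr).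

Lemma dotuu u : dot u u = (rnorm u ^+ 2)%:C.
Proof. by rewrite hdot rnormE rmorphXn. Qed.

Lemma ipuu u : ip u u = rnorm u ^+ 2.
Proof. by rewrite /ip dotuu. Qed.

(** Cauchy-Schwarz for any nonnegative quadratic form: a, b and c are its values
    on (u, u), (u, v) and (v, v), and the hypothesis is that it is nonnegative
    on u + x v. *)
Lemma discriminant_le (a b c : R) :
  (forall x, 0 <= a + 2 * b * x + c * x ^+ 2) -> b ^+ 2 <= a * c.
Proof.
move=> q; have c0 : 0 <= c.
  rewrite leNgt; apply/negP => c0.
  have a0 : 0 <= a by have := q 0; rewrite mulr0 expr0n /= mulr0 !addr0.
  (* so large that c x ^ 2 outweighs a + 2 b x *)
  pose x := (`|b| * 2 + a + 1) / - c + 1.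
  have nc : 0 < - c by rewrite oppr_gt0.
  have x1 : 1 <= x by rewrite lerDr divr_ge0 ?ltW//; have := normr_ge0 b; lra.
  have xE : - c * x = `|b| * 2 + a + 1 - c.
    by rewrite /x mulrDr mulrCA mulfV ?gt_eqF// !mulr1.
  have := q x; have := ler_norm b; nra.
have [c_eq|c_gt] := eqVneq c 0.
  subst c; have [->|b0] := eqVneq b 0; first by rewrite expr0n mulr0.
  have := q (- (a + 1) / (2 * b)).
  rewrite mulrCA mulfV ?mulf_neq0 ?pnatr_eq0//; lra.
have cp : 0 < c by rewrite lt_neqAle eq_sym c_gt.
have := q (- b / c) => qx.
have : 0 <= (a + 2 * b * (- b / c) + c * (- b / c) ^+ 2) * c by rewrite mulr_ge0.
have -> : (a + 2 * b * (- b / c) + c * (- b / c) ^+ 2) * c = a * c - b ^+ 2.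
  by field.
by rewrite subr_ge0.
Qed.

Lemma ip_CauchySchwarz u v : `|ip u v| <= rnorm u * rnorm v.
Proof.
rewrite -(@ler_pXn2r _ 2%N)// ?nnegrE ?mulr_ge0 ?rnorm_ge0//.
rewrite real_normK ?num_real// exprMn -!ipuu.
apply: discriminant_le => x; have := sqr_ge0 (rnorm (u + x%:C *: v)).
rewrite -ipuu !ipE (ipC v u); nra.
Qed.

Lemma ip_le u v : ip u v <= rnorm u * rnorm v.
Proof. exact: le_trans (ler_norm _) (ip_CauchySchwarz u v). Qed.

Lemma normc_dot_le u v : normc (dot u v) <= rnorm u * rnorm v.
Proof.
have [d0|d0] := eqVneq (dot u v) 0.
  by rewrite d0 normcR normr0 mulr_ge0 ?rnorm_ge0.
have := ip_le u (dot u v *: v).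
rewrite rnormZ /ip dotZr.
have -> : complex.Re ((dot u v)^* * dot u v) = normc (dot u v) ^+ 2.
  by rewrite normcsq; case: (dot u v) => a b /=; ring.
rewrite expr2 mulrCA ler_pM2l// lt_neqAle normc_ge0 andbT eq_sym.
by apply: contra_neq d0 => /eq0_normc.
Qed.

(** The passage from real to complex orthogonality, for complex subspaces. *)
Lemma dot_eq0 u e : ip u e = 0 -> ip u ('i%C *: e) = 0 -> dot u e = 0.
Proof.
rewrite /ip dotZr; case: (dot u e) => a b /= -> /eqP.
by rewrite mulr0 mulN1r opprK add0r => /eqP ->.
Qed.

Lemma rnormD_sq u v : dot u v = 0 ->
  rnorm (u + v) ^+ 2 = rnorm u ^+ 2 + rnorm v ^+ 2.
Proof.
move=> uv; rewrite -!ipuu !ipE (ipC v u).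
have -> : ip u v = 0 by rewrite /ip uv.
by ring.
Qed.

End InnerProduct.

(** * Geometric convergence *)

Section Geometric.
Variable R : realType.

Lemma geometric_small (C q e : R) : 0 <= q < 1 -> 0 < e ->
  exists N, forall k, (N <= k)%N -> C * q ^+ k < e.
Proof.
move=> /andP[q0 q1] e0.
have : geometric C q @ \oo --> (0 : R).
  by apply: cvg_geometric; rewrite ger0_norm.
move=> /cvgrPdist_lt /(_ _ e0) [N _ hN]; exists N => k /hN.
by rewrite sub0r normrN; apply: le_lt_trans; exact: ler_norm.
Qed.

Lemma le_of_le_geometric (a b C q : R) : 0 <= q < 1 -> (forall k, a <= b + C * q ^+ k) ->
  a <= b.
Proof.
move=> q01 h; rewrite leNgt; apply/negP => ab.
have [|N hN] := @geometric_small C q (a - b) q01; first by rewrite subr_gt0.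
have := hN N (leqnn _); have := h N; lra.
Qed.

End Geometric.

Section Completeness.
Variables (R : realType) (H : completeNormedModType R[i]).

(** The explicit rate lets every later passage to the limit be made with
    [le_of_le_geometric]. *)
Lemma geometric_steps_cvg (x : nat -> H) (C q : R) : 0 <= q < 1 ->
  (forall k, rnorm (x k.+1 - x k) <= C * q ^+ k) ->
  exists p, forall k, rnorm (x k - p) <= C / (1 - q) * q ^+ k.
Proof.
move=> /[dup] q01 /andP[q0 q1] hx.
have q1' : 0 < 1 - q by rewrite subr_gt0.
have C0 : 0 <= C.
  by have := hx 0%N; rewrite expr0 mulr1; apply: le_trans; exact: rnorm_ge0.
have D0 : 0 <= C / (1 - q) by rewrite divr_ge0// ltW.
have hd n k : rnorm (x (n + k)%N - x n) <= C / (1 - q) * (q ^+ n - q ^+ (n + k)).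
  elim: k => [|k IH]; first by rewrite addn0 !subrr mulr0 rnorm0.
  rewrite addnS -(subrKA (x (n + k)%N)); apply: le_trans (rnormD _ _) _.
  apply: le_trans (lerD (hx _) IH) _; rewrite exprS.
  rewrite le_eqVlt; apply/orP; left; apply/eqP.
  move: (q ^+ (n + k)) (q ^+ n) => a b; field.
  by rewrite subr_eq0 eq_sym lt_eqF.
have hd' n k : rnorm (x (n + k)%N - x n) <= C / (1 - q) * q ^+ n.
  apply: le_trans (hd n k) _; apply: ler_wpM2l => //.
  by rewrite gerBl exprn_ge0.
have cx : cvgn x.
  apply/cauchy_cvgP; apply: cauchy_exP => e e0.
  have re0 : 0 < complex.Re e by move: e0; rewrite ltcE => /andP[].
  have eE : e = (complex.Re e)%:C.
    by rewrite RRe_real// gtr0_real.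
  have [N hN] := geometric_small (C / (1 - q)) q01 re0.
  exists (x N); exists N => // k /= Nk; rewrite -ball_normE /= eE rnormE ltcR.
  rewrite rnormC -(subnKC Nk).
  have := hd' N (k - N)%N; have := hN N (leqnn _); lra.
exists (limn x) => k; apply/ler_addgt0Pr => e e0.
move/cvgrPdist_lt: cx => /(_ e%:C); rewrite ltcR => /(_ e0) [N _ hN].
have := hN (k + N)%N (leq_addl _ _); rewrite rnormE ltcR rnormC => h.
rewrite -(subrKA (x (k + N)%N)); apply: le_trans (rnormD _ _) _.
rewrite rnormC; apply: lerD; [exact: hd'|exact: ltW].
Qed.

End Completeness.

(** * Shifted operators and orthogonal complements of eigenvectors *)

Section Shift.
Variables (R : realType) (H : normedModType R[i]) (A : operator H).
Implicit Types (u v w : H) (z : R[i]) (a c : R).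

Definition shift z u : H := A u - z *: u.

Lemma domD u v : dom A u -> dom A v -> dom A (u + v).
Proof. by move=> Du Dv; rewrite -[u]scale1r; exact: dom_lin. Qed.

Lemma domZ z u : dom A u -> dom A (z *: u).
Proof. by move=> Du; rewrite -[_ *: _]addr0; apply: dom_lin => //; exact: dom0. Qed.

Lemma domN u : dom A u -> dom A (- u).
Proof. by rewrite -scaleN1r; exact: domZ. Qed.

Lemma domB u v : dom A u -> dom A v -> dom A (u - v).
Proof. by move=> Du /domN; exact: domD. Qed.

Lemma dom_sum n (f : 'I_n -> H) (P : pred 'I_n) :
  (forall i, P i -> dom A (f i)) -> dom A (\sum_(i | P i) f i).
Proof. by move=> Df; elim/big_ind: _ => // [|*]; [exact: dom0|exact: domD]. Qed.

Lemma shiftD z u v : dom A u -> dom A v -> shift z (u + v) = shift z u + shift z v.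
Proof.
move=> Du Dv; rewrite /shift -{1}[u]scale1r opfun_lin// scale1r scalerDr opprD.
by rewrite addrACA.
Qed.

Lemma shiftZ z (a : R[i]) u : dom A u -> shift z (a *: u) = a *: shift z u.
Proof.
move=> Du; have A0 : A 0 = 0.
  have := opfun_lin (-1) (dom0 A) (dom0 A).
  by rewrite scaler0 addr0 scaleN1r addNr.
rewrite /shift -[X in A X]addr0 opfun_lin//; last exact: dom0.
by rewrite A0 addr0 scalerBr !scalerA (mulrC z).
Qed.

Lemma shift0 z : shift z 0 = 0.
Proof. by have := shiftZ z 0 (dom0 A); rewrite !scale0r. Qed.

Lemma shiftN z u : dom A u -> shift z (- u) = - shift z u.
Proof. by move=> Du; rewrite -scaleN1r shiftZ// scaleN1r. Qed.

Lemma shiftB z u v : dom A u -> dom A v -> shift z (u - v) = shift z u - shift z v.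
Proof. by move=> Du Dv; rewrite shiftD ?shiftN//; exact: domN. Qed.

Lemma shift_sum z n (f : 'I_n -> H) (P : pred 'I_n) :
  (forall i, dom A (f i)) -> shift z (\sum_(i | P i) f i) = \sum_(i | P i) shift z (f i).
Proof.
move=> Df; apply: (@proj1 _ (dom A (\sum_(i | P i) f i))).
elim/big_rec2: _ => [|i y x _ [<- Dy]]; first by rewrite shift0; split=> //; exact: dom0.
by rewrite shiftD//; split=> //; exact: domD.
Qed.

Lemma shift_change z z' u : shift z' u = shift z u + (z - z') *: u.
Proof. by rewrite /shift scalerBl addrA subrK. Qed.

Lemma eigenspaceP z u : eigenspace A z u <-> dom A u /\ shift z u = 0.
Proof.
split=> -[Du e]; split=> //; first by rewrite /shift e subrr.
by apply/eqP; rewrite -subr_eq0 -/(shift z u) e.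
Qed.

Lemma shift_eigen z z' u : eigenspace A z u -> shift z' u = (z - z') *: u.
Proof. by move=> /eigenspaceP[_ e]; rewrite (shift_change z) e add0r. Qed.

Lemma eigenspaceZ z (a : R[i]) u : eigenspace A z u -> eigenspace A z (a *: u).
Proof.
move=> /eigenspaceP[Du e]; apply/eigenspaceP.
by rewrite shiftZ// e scaler0; split=> //; exact: domZ.
Qed.

End Shift.

Section Regular.
Variables (R : realType) (H : completeNormedModType R[i]) (dot : {dot H for Num.conj}).
Hypothesis hdot : norm_induced_by dot.
Variable A : operator H.
Hypothesis sym : forall u v, dom A u -> dom A v -> dot (A u) v = dot u (A v).
Implicit Types (S : set H) (u v w : H) (z : R[i]) (a c : R).

Lemma shift_sym z u v : dom A u -> dom A v -> dot (shift A z u) v = dot u (shift A z^* v).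
Proof.
move=> Du Dv; rewrite /shift dotBl dotBr sym// dotZl dotZr.
by rewrite conjCK.
Qed.

Lemma conj_real a : (a%:C : R[i])^* = a%:C.
Proof. exact: conjc_real. Qed.

Lemma shiftR_sym a u v : dom A u -> dom A v ->
  dot (shift A a%:C u) v = dot u (shift A a%:C v).
Proof. by move=> Du Dv; rewrite shift_sym// conj_real. Qed.

Lemma shiftR_sym_ip a u v : dom A u -> dom A v ->
  ip dot (shift A a%:C u) v = ip dot u (shift A a%:C v).
Proof. by move=> Du Dv; rewrite /ip shiftR_sym. Qed.

Definition orth S : set H := [set w | forall e, S e -> dot w e = 0].

Lemma orth_lin S z u v : orth S u -> orth S v -> orth S (z *: u + v).
Proof. by move=> Mu Mv e Se; rewrite dotDl dotZl Mu// Mv// mulr0 addr0. Qed.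

Lemma orth0 S : orth S 0.
Proof. by move=> e _; rewrite dot0l. Qed.

Lemma orthB S u v : orth S u -> orth S v -> orth S (u - v).
Proof. by move=> Du Dv; rewrite addrC -scaleN1r; exact: orth_lin. Qed.

Lemma orth_lim S (x : nat -> H) p (C q : R) : 0 <= q < 1 ->
  (forall k, orth S (x k)) -> (forall k, rnorm (x k - p) <= C * q ^+ k) -> orth S p.
Proof.
move=> q01 Mx xp e Se; apply: eq0_normc; apply: le_anti; rewrite normc_ge0 andbT.
apply: (@le_of_le_geometric _ _ _ (C * rnorm e) _ q01) => k; rewrite add0r.
have -> : dot p e = dot (p - x k) e by rewrite dotBl (Mx k)// subr0.
apply: le_trans (normc_dot_le hdot _ _) _; rewrite rnormC mulrAC.
by apply: ler_wpM2r; rewrite ?rnorm_ge0.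
Qed.

(** The points of the resolvent set of A restricted to the orthogonal complement
    of S, with a lower bound c for the restriction of A - z. *)
Definition regular_on S z c := [/\ 0 < c,
  forall w, orth S w -> exists u, [/\ dom A u, orth S u & shift A z u = w] &
  forall u, dom A u -> orth S u -> c * rnorm u <= rnorm (shift A z u)].

Lemma resolvent_regular z : resolvent_set A z <-> exists c, regular_on set0 z c.
Proof.
split=> [[surj [c hc]]|[c [c0 surj hc]]].
  exists (`|c| + 1)^-1; have c0 : 0 < `|c| + 1 by rewrite ltr_wpDl.
  split=> [|w _|u Du _]; first by rewrite invr_gt0.
    by have [u [[Du uw] _]] := surj w; exists u; split.
  rewrite -ler_pdivlMl ?invr_gt0// invrK; apply: le_trans (hc u Du) _.
  apply: ler_wpM2r; rewrite ?rnorm_ge0//.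
  by apply: le_trans (ler_norm c) _; rewrite lerDl.
split=> [w|].
  have [//|u [Du _ uw]] := surj w; exists u; split=> // v [Dv]; rewrite -/(shift A z v) => vw.
  apply/eqP; rewrite -subr_eq0 -rnorm_eq0 eq_le rnorm_ge0 andbT.
  rewrite -(pmulr_rle0 _ c0); apply: le_trans (hc _ (domB Du Dv) _) _ => //.
  by rewrite shiftB// uw vw subrr rnorm0.
by exists c^-1 => u Du; rewrite ler_pdivlMl//; exact: hc.
Qed.

Lemma resolvent_eigen z u : resolvent_set A z -> eigenspace A z u -> u = 0.
Proof.
move=> /resolvent_regular[c [c0 _ hc]] /eigenspaceP[Du e].
apply/eqP; rewrite -rnorm_eq0 eq_le rnorm_ge0 andbT -(pmulr_rle0 _ c0).
by apply: le_trans (hc _ Du _) _; rewrite ?e ?rnorm0.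
Qed.

Definition real_eigenvectors S := forall e, S e -> exists l : R, eigenspace A l%:C e.

(** A - z maps the orthogonal complement of a set of eigenvectors to itself, and
    so does its inverse: pairing (A - z) u with an eigenvector e multiplies
    dot u e by a nonzero number. *)
Lemma regular_orth S z : real_eigenvectors S -> resolvent_set A z ->
  exists c, regular_on S z c.
Proof.
move=> hS rz; have /resolvent_regular[c [c0 surj hc]] := rz; exists c; split=> //.
  move=> w Mw; have [//|u [Du _ uw]] := surj w; exists u; split=> // e Se.
  have [l el] := hS _ Se; have [lz|lz] := eqVneq l%:C z.
    by rewrite (resolvent_eigen rz (u := e)) ?dot0r// -lz.
  have := Mw _ Se; rewrite -uw shift_sym//; last by case: el.
  rewrite (shift_eigen _ el) dotZr => /eqP; rewrite mulf_eq0 => /orP[|/eqP//].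
  rewrite rmorphB /= conj_real conjCK subr_eq0 => /eqP lz'.
  by rewrite lz' eqxx in lz.
by move=> u Du _; exact: hc.
Qed.

(** With T the inverse of A - z, the equation (A - z') u = w is the fixed point
    equation u = T (w + (z' - z) u), which is a contraction of ratio
    |z' - z| / c. *)
Lemma regular_on_perturb S z z' c : regular_on S z c -> normc (z' - z) < c ->
  regular_on S z' (c - normc (z' - z)).
Proof.
set n := normc (z' - z); move=> [c0 surj hc] nc.
have hc' u : dom A u -> orth S u -> (c - n) * rnorm u <= rnorm (shift A z' u).
  move=> Du Mu; rewrite mulrBl lerBlDr; apply: le_trans (hc u Du Mu) _.
  rewrite (shift_change _ z' z); apply: le_trans (rnormD _ _) _.
  by rewrite rnormZ.
split=> //; first by rewrite subr_gt0.
move=> w Mw.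
have /choice[T hT] : forall v, exists u, orth S v ->
    [/\ dom A u, orth S u & shift A z u = v].
  move=> v; have [Mv|nMv] := pselect (orth S v).
    by have [u hu] := surj v Mv; exists u.
  by exists 0.
pose g x := T (w + (z' - z) *: x).
have Mg x : orth S x -> orth S (w + (z' - z) *: x).
  by move=> Mx; rewrite addrC; exact: orth_lin.
have gM x : orth S x -> [/\ dom A (g x), orth S (g x) & shift A z (g x) = w + (z' - z) *: x].
  by move=> Mx; exact: hT (Mg x Mx).
pose q := n / c; have q01 : 0 <= q < 1.
  by rewrite ltr_pdivrMr// mul1r nc andbT divr_ge0// ?normc_ge0// ltW.
have gq x y : orth S x -> orth S y -> rnorm (g x - g y) <= q * rnorm (x - y).
  move=> /gM[Dx Mx ex] /gM[Dy My ey].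
  rewrite /q mulrAC ler_pdivlMr// mulrC; apply: le_trans (hc _ (domB Dx Dy) (orthB Mx My)) _.
  by rewrite shiftB// ex ey opprD addrACA subrr add0r -scalerBr rnormZ.
clearbody q; pose x k := iter k g 0.
have Mx k : orth S (x k) by elim: k => [|k IH]; [exact: orth0|have [] := gM _ IH].
have [p hp] : exists p, forall k, rnorm (x k - p) <= rnorm (x 1%N - x 0%N) / (1 - q) * q ^+ k.
  apply: geometric_steps_cvg => //; elim=> [|k IH]; first by rewrite expr0 mulr1.
  apply: le_trans (gq (x k.+1) (x k) (Mx _) (Mx _)) _.
  by rewrite exprS mulrCA; apply: ler_wpM2l => //; case/andP: q01.
have Mp : orth S p by exact: (orth_lim q01 Mx hp).
have [Dg _ ge] := gM _ Mp.
have pg : p = g p.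
  set C := _ / _ in hp.
  apply/eqP; rewrite -subr_eq0 -rnorm_eq0 eq_le rnorm_ge0 andbT.
  apply: (@le_of_le_geometric _ _ _ (C * q + q * C) _ q01) => k; rewrite add0r.
  rewrite -(subrKA (x k.+1)) mulrDl; apply: le_trans (rnormD _ _) _; apply: lerD.
    by rewrite rnormC -mulrA -exprS.
  apply: le_trans (gq (x k) p (Mx _) Mp) _; rewrite -mulrA.
  by apply: ler_wpM2l => //; case/andP: q01.
exists p; split=> //; first by rewrite pg.
rewrite (shift_change _ z) [in shift _ _ p]pg ge -addrA -scalerDl.
by rewrite -[z' - z]opprB addNr scale0r addr0.
Qed.

(** This stands in for the spectral theorem: a self-adjoint operator is bounded
    below by its distance to the spectrum.  With B = A - s and c the infimum of
    |B u| / |u|, the form q u v = <B u, B v> - c ^ 2 <u, v> is nonnegative.  If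
    B - c and B + c are invertible with lower bounds c1 and c2, every w has a
    preimage v under their product, q u v = <u, w> for all u, and
    q w v ^ 2 <= q w w * q v v reads q w w >= c1 c2 |w| ^ 2, so that c is not
    the infimum. *)
Lemma regular_gap S (s g : R) :
  (forall c, 0 <= c < g -> (exists c', regular_on S (s + c)%:C c') /\
     (exists c', regular_on S (s - c)%:C c')) ->
  forall u, dom A u -> orth S u -> g * rnorm u <= rnorm (shift A s%:C u).
Proof.
move=> hreg u Du Mu.
have [->|u0] := eqVneq u 0; first by rewrite rnorm0 mulr0 rnorm_ge0.
pose E := [set rnorm (shift A s%:C v) / rnorm v | v in
             [set v | [/\ dom A v, orth S v & v != 0]]].
have Elb : lbound E 0.
  by move=> _ [v _ <-]; rewrite divr_ge0 ?rnorm_ge0.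
have Eu : E (rnorm (shift A s%:C u) / rnorm u) by exists u.
have E0 : E !=set0 by exists (rnorm (shift A s%:C u) / rnorm u).
have Einf : has_inf E by split=> //; exists 0.
pose c := inf E.
have c0 : 0 <= c by exact: lb_le_inf.
have cle v : dom A v -> orth S v -> c * rnorm v <= rnorm (shift A s%:C v).
  move=> Dv Mv; have [->|v0] := eqVneq v 0; first by rewrite rnorm0 mulr0 rnorm_ge0.
  rewrite -ler_pdivlMr ?rnorm_gt0//; apply: ge_inf; first by exists 0.
  by exists v.
have [gc|cg] := leP g c.
  by apply: le_trans (cle u Du Mu); apply: ler_wpM2r; rewrite ?rnorm_ge0.
exfalso.
have [|[c1 [c10 surj1 b1]] [c2 [c20 surj2 b2]]] := hreg c; first by rewrite c0.
pose B := shift A s%:C.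
have Bp v : shift A (s + c)%:C v = B v - c%:C *: v.
  by rewrite (shift_change _ s%:C) rmorphD/= opprD addrA subrr sub0r scaleNr.
have Bm v : shift A (s - c)%:C v = B v + c%:C *: v.
  by rewrite (shift_change _ s%:C) rmorphB/= opprB addrCA subrr addr0.
have key w : dom A w -> orth S w -> (c ^+ 2 + c1 * c2) * rnorm w ^+ 2 <= rnorm (B w) ^+ 2.
  move=> Dw Mw.
  have [v1 [Dv1 Mv1]] := surj1 w Mw; rewrite Bp => e1.
  have [v [Dv Mv]] := surj2 v1 Mv1; rewrite Bm => e2.
  have B1 : B v1 = w + c%:C *: v1 by rewrite -e1 subrK.
  have B2 : B v = v1 - c%:C *: v by rewrite -e2 addrK.
  pose q x y := ip dot (B x) (B y) - c ^+ 2 * ip dot x y.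
  have qxv x : dom A x -> q x v = ip dot x w.
    move=> Dx; rewrite /q B2 ipDr ipNr ipZr (shiftR_sym_ip _ Dx Dv1).
    rewrite (shiftR_sym_ip _ Dx Dv) -/B B1 B2 !(ipDr, ipNr, ipZr).
    by ring.
  have qge0 x : dom A x -> orth S x -> 0 <= q x x.
    move=> Dx Mx; rewrite /q !ipuu// -exprMn subr_ge0.
    by rewrite ler_pXn2r ?nnegrE ?mulr_ge0 ?rnorm_ge0//; exact: cle.
  have qCS : q w v ^+ 2 <= q w w * q v v.
    apply: discriminant_le => a.
    have := qge0 (w + a%:C *: v) (domD Dw (domZ _ Dv)).
    rewrite addrC => /(_ (orth_lin a%:C Mv Mw)).
    rewrite /q {1 2}/B shiftD ?shiftZ//; last exact: domZ.
    rewrite -/B; move: (B w) (B v) => bw bv.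
    rewrite !ipE (ipC dot bv bw) (ipC dot v w); lra.
  have [->|w0] := eqVneq w 0; first by rewrite rnorm0 expr0n mulr0 sqr_ge0.
  have wp : 0 < rnorm w by rewrite rnorm_gt0.
  rewrite !qxv// in qCS; rewrite ipuu// in qCS.
  have vw : ip dot v w * (c1 * c2) <= rnorm w ^+ 2.
    have := b1 _ Dv1 Mv1; rewrite Bp e1 => h1.
    have := b2 _ Dv Mv; rewrite Bm e2 => h2.
    have h3 := ip_le hdot v w.
    have h4 : rnorm v * (c1 * c2) <= rnorm w.
      apply: le_trans h1; rewrite (mulrC c1) mulrA mulrC ler_pM2l//.
      by rewrite mulrC.
    have := rnorm_ge0 w; have : 0 < c1 * c2 by rewrite mulr_gt0.
    nra.
  have qw0 := qge0 _ Dw Mw.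
  have : (c1 * c2) * rnorm w ^+ 2 <= q w w.
    have w2 : 0 < rnorm w ^+ 2 by rewrite exprn_gt0.
    rewrite -(ler_pM2r w2).
    have -> : c1 * c2 * rnorm w ^+ 2 * rnorm w ^+ 2 = c1 * c2 * (rnorm w ^+ 2) ^+ 2.
      by ring.
    apply: (@le_trans _ _ (c1 * c2 * (q w w * ip dot v w))).
      by rewrite ler_pM2l ?mulr_gt0.
    rewrite mulrCA (mulrC _ (ip _ _ _)); exact: ler_wpM2l.
  rewrite /q !ipuu//; lra.
pose g' := Num.sqrt (c ^+ 2 + c1 * c2).
have cc : 0 < c1 * c2 by rewrite mulr_gt0.
have g2 : g' ^+ 2 = c ^+ 2 + c1 * c2.
  by rewrite sqr_sqrtr// addr_ge0 ?sqr_ge0// ltW.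
have g'0 : 0 <= g' by exact: sqrtr_ge0.
have cg' : c < g' by nra.
have : g' <= c.
  apply: lb_le_inf => // _ [v [Dv Mv v0] <-].
  rewrite ler_pdivlMr ?rnorm_gt0//.
  rewrite -(@ler_pXn2r _ 2%N)// ?nnegrE ?mulr_ge0 ?rnorm_ge0//.
  by rewrite exprMn g2; exact: key.
by rewrite leNgt cg'.
Qed.

End Regular.

(** * Points isolated in the spectrum *)

Section Isolated.
Variables (R : realType) (H : completeNormedModType R[i]) (dot : {dot H for Num.conj}).
Hypothesis hdot : norm_induced_by dot.
Implicit Types (u v w : H) (z : R[i]) (a c : R).

(** V is symmetric with 0 <= V <= 1, and the last hypothesis is
    (1 - V) (2/3 - V) >= 0: its spectrum is in [0, 2/3] and {1}.  The quantity
    g x = <(1 - V) x, x> shrinks by 2/3 at each application of V; it is at least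
    |V x - x| ^ 2, and 5/3 of it at least |x| ^ 2 - |V x| ^ 2.  Hence the iterates
    converge, and their squared norms drop by at most 5 g x in all. *)
Lemma iter_cvg_fixpoint (V : H -> H) :
  (forall x y, V (x - y) = V x - V y) ->
  (forall x y, ip dot (V x) y = ip dot x (V y)) ->
  (forall x, rnorm (V x) ^+ 2 <= ip dot x (V x)) ->
  (forall x, 0 <= 2 * rnorm x ^+ 2 - 5 * ip dot x (V x) + 3 * rnorm (V x) ^+ 2) ->
  forall x, exists p, [/\ V p = p,
    forall e, V e = e -> ip dot (x - p) e = 0 &
    p = 0 -> rnorm x ^+ 2 <= 5 * (rnorm x ^+ 2 - ip dot x (V x))].
Proof.
move=> VB Vsym Vle Vgap x.
pose X k := iter k V x.
pose g y := rnorm y ^+ 2 - ip dot y (V y).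
have Vcontr y : rnorm (V y) <= rnorm y.
  have h1 := Vle y; have h2 := ip_le hdot y (V y).
  have h3 := rnorm_ge0 y; have h4 := rnorm_ge0 (V y).
  rewrite leNgt; apply/negP => h5; nra.
have g_ge0 y : 0 <= g y.
  have h1 := Vcontr y; have h2 := ip_le hdot y (V y).
  have h3 := rnorm_ge0 y; have h4 := rnorm_ge0 (V y); rewrite /g; nra.
have dist y : rnorm (V y - y) ^+ 2 <= g y.
  rewrite -(ipuu hdot) !ipE !ipuu// (ipC dot (V y)) /g; have := Vle y; lra.
(* <V (1 - V) y, (1 - V) y> >= 0 gives g (V y) <= <V y, y> - |V y| ^ 2, which is
   at most 2/3 g y by the gap *)
have gV y : 3 * g (V y) <= 2 * g y.
  have h1 := Vle (y - V y); have h2 := Vgap y.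
  have : 0 <= ip dot (y - V y) (V (y - V y)).
    by apply: le_trans (Vle _); exact: sqr_ge0.
  have e : ip dot y (V (V y)) = rnorm (V y) ^+ 2 by rewrite -Vsym ipuu.
  rewrite VB !ipE e (ipuu hdot (V y)) /g; lra.
(* any q < 1 with q ^ 2 >= 2/3 *)
pose q : R := 9 / 10.
have q01 : 0 <= q < 1 by rewrite /q; lra.
have gX k : g (X k) <= (q ^+ k) ^+ 2 * g x.
  elim: k => [|k IH]; first by rewrite expr0 expr1n mul1r.
  rewrite [q ^+ _]exprS exprMn -mulrA; have := gV (X k); rewrite -/(X k.+1) => h.
  have := g_ge0 (X k); rewrite /q expr2; lra.
have sg : Num.sqrt (g x) ^+ 2 = g x by rewrite sqr_sqrtr.
have step k : rnorm (X k.+1 - X k) <= Num.sqrt (g x) * q ^+ k.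
  rewrite -(@ler_pXn2r _ 2%N)// ?nnegrE ?rnorm_ge0//; last first.
    by rewrite mulr_ge0 ?sqrtr_ge0// exprn_ge0//; case/andP: q01.
  by rewrite exprMn sg mulrC; apply: le_trans (dist _) (gX _).
have [p hp] := geometric_steps_cvg q01 step; set C := _ / _ in hp.
have q0 k : 0 <= q ^+ k by rewrite exprn_ge0//; case/andP: q01.
exists p; split.
- apply/eqP; rewrite -subr_eq0 -rnorm_eq0 eq_le rnorm_ge0 andbT.
  apply: (@le_of_le_geometric _ _ _ (C + C * q) _ q01) => k; rewrite add0r mulrDl.
  rewrite -(subrKA (X k.+1)); apply: le_trans (rnormD _ _) _; apply: lerD.
    rewrite /= -VB; apply: le_trans (Vcontr _) _; rewrite rnormC; exact: hp.
  by rewrite -mulrA -exprS; exact: hp.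
- move=> e Ve; have Xe k : ip dot (X k) e = ip dot x e.
    by elim: k => // k IH; rewrite /= Vsym Ve.
  apply/eqP; rewrite -normr_eq0 eq_le normr_ge0 andbT.
  apply: (@le_of_le_geometric _ _ _ (C * rnorm e) _ q01) => k; rewrite add0r mulrAC.
  have -> : ip dot (x - p) e = ip dot (X k - p) e by rewrite !ipE Xe.
  apply: le_trans (ip_CauchySchwarz hdot _ _) _.
  by apply: ler_wpM2r => //; exact: rnorm_ge0.
- move=> p0; rewrite -/(g x).
  have drop k : rnorm x ^+ 2 - rnorm (X k) ^+ 2 <= 5 * (g x - g (X k)).
    elim: k => [|k IH]; first by rewrite /= !subrr mulr0.
    have h := gV (X k); have := Vgap (X k).
    by move: IH h; rewrite -/(X k.+1) /g /=; lra.
  apply: (@le_of_le_geometric _ _ _ (C ^+ 2) _ q01) => k.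
  have h1 := drop k; have h2 := g_ge0 (X k); have := hp k.
  rewrite p0 subr0 => h3; have h4 := rnorm_ge0 (X k).
  have qk1 : q ^+ k <= 1 by apply: exprn_ile1; case/andP: q01 => // _ /ltW.
  have h5 : rnorm (X k) ^+ 2 <= (C * q ^+ k) ^+ 2.
    by rewrite ler_pXn2r ?nnegrE// (le_trans h4).
  have h6 : (C * q ^+ k) ^+ 2 <= C ^+ 2 * q ^+ k.
    rewrite exprMn; apply: ler_wpM2l; first exact: sqr_ge0.
    by rewrite expr2; exact: ler_piMr.
  lra.
Qed.

Variable A : operator H.
Hypothesis sym : forall u v, dom A u -> dom A v -> dot (A u) v = dot u (A v).

Definition ortho_eigen (l : R) : set H := orth dot (eigenspace A l%:C).

(** With T the inverse of A - (mu + r), the symmetric operator -r T has norm at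
    most 1 and fixes exactly ker (A - mu); V is its mean with the
    identity, which moves the spectrum to the nonnegative side.  The gap of V
    is the lower bound r for A - (mu - r). *)
Lemma punctured_split (mu r : R) : 0 < r ->
  (forall x : R, 0 < `|x - mu| < 2 * r -> resolvent_set A x%:C) ->
  (forall x, exists2 p, eigenspace A mu%:C p & ortho_eigen mu (x - p)) /\
  (forall u, dom A u -> ortho_eigen mu u ->
     2 / 5 * r * rnorm u <= rnorm (shift A mu%:C u)).
Proof.
move=> r0 hres.
have reg y : 0 < y < 2 * r -> (exists c', regular_on dot A set0 (mu + y)%:C c') /\
    (exists c', regular_on dot A set0 (mu - y)%:C c').
  move=> /andP[y0 yr]; split; apply/resolvent_regular/hres; rewrite addrAC subrr add0r.
    by rewrite gtr0_norm ?y0.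
  by rewrite normrN gtr0_norm ?y0.
have low (s : R) : s = mu + r \/ s = mu - r -> forall u, dom A u ->
    r * rnorm u <= rnorm (shift A s%:C u).
  move=> sr u Du; apply: (regular_gap hdot sym (S := set0)) => // c /andP[c0 cr].
  have [|p1 m1] := reg (r + c); first by lra.
  have [|p2 m2] := reg (r - c); first by lra.
  case: sr => ->.
    have -> : mu + r + c = mu + (r + c) by ring.
    by have -> : mu + r - c = mu + (r - c) by ring.
  have -> : mu - r + c = mu - (r - c) by ring.
  by have -> : mu - r - c = mu - (r + c) by ring.
pose s := mu + r.
have [|[c [c0 surj cb]] _] := reg r; first by lra.
have /choice[T hT] : forall w, exists u, dom A u /\ shift A s%:C u = w.
  by move=> w; have [//|u []] := surj w; exists u.
have T_D w : dom A (T w) by have [] := hT w.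
have TK w : shift A s%:C (T w) = w by have [] := hT w.
have inj u v : dom A u -> dom A v -> shift A s%:C u = shift A s%:C v -> u = v.
  move=> Du Dv e; apply/eqP; rewrite -subr_eq0 -rnorm_eq0 eq_le rnorm_ge0 andbT.
  rewrite -(pmulr_rle0 _ c0); apply: le_trans (cb _ (domB Du Dv) _) _ => //.
  by rewrite shiftB// e subrr rnorm0.
have KT u : dom A u -> T (shift A s%:C u) = u.
  by move=> Du; apply: inj; rewrite ?TK.
have TB x y : T (x - y) = T x - T y.
  by apply: inj => //; [exact: domB|rewrite shiftB// !TK].
have Tsym x y : ip dot (T x) y = ip dot x (T y).
  by rewrite -{1}(TK y) -(shiftR_sym_ip sym)// TK.
have mus u : shift A mu%:C u = shift A s%:C u + r%:C *: u.
  rewrite (shift_change _ s%:C); congr (_ + _ *: _).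
  by rewrite -rmorphB/= /s addrAC subrr add0r.
have Tr x : r * rnorm (T x) <= rnorm x.
  by rewrite -{2}(TK x); exact: (low s (or_introl erefl)).

have Tgap x : 0 <= rnorm x ^+ 2 + 4 * r * ip dot x (T x) + 3 * r ^+ 2 * rnorm (T x) ^+ 2.
  have := low (mu - r) (or_intror erefl) (T x) (T_D x).
  have -> : shift A (mu - r)%:C (T x) = x + (2 * r)%:C *: T x.
    rewrite (shift_change _ s%:C) TK; congr (_ + _ *: _).
    by rewrite -rmorphB/= /s; congr (_ %:C); ring.
  rewrite -(@ler_pXn2r _ 2%N)// ?nnegrE ?mulr_ge0 ?rnorm_ge0// ?(ltW r0)//.
  rewrite exprMn -(ipuu hdot) -(ipuu hdot (_ + _)) !ipE (ipC dot (T x) x) !ipuu//.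
  lra.
pose V w := (2^-1)%:C *: (w - r%:C *: T w).
have half w : w = (2^-1)%:C *: (w + w).
  rewrite -mulr2n -[w *+ 2]scaler_nat scalerA -(rmorph_nat (real_complex R)).
  by rewrite -rmorphM/= mulVf// scale1r.
have VTK w : V w = w <-> w + r%:C *: T w = 0.
  have e : V w - w = - (2^-1)%:C *: (w + r%:C *: T w).
    rewrite {2}[w]half /V -scalerBr scaleNr -scalerN; congr (_ *: _).
    by rewrite !opprD addrACA addrA addrAC subrr add0r.
  split=> [h|h]; last by apply/eqP; rewrite -subr_eq0 e h scaler0.
  move/eqP: e; rewrite h subrr eq_sym scaler_eq0 oppr_eq0 => /orP[|/eqP//].
  by rewrite -(rmorph0 (real_complex R)) => /eqP/complexI/eqP; rewrite invr_eq0 pnatr_eq0.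
have VkerE w : V w = w <-> eigenspace A mu%:C w.
  rewrite VTK; split=> [/eqP|/eigenspaceP[Dw]].
    rewrite addr_eq0 => /eqP h; have Dw : dom A w.
      by rewrite h; apply: domN; exact: domZ.
    apply/eigenspaceP; split=> //.
    by rewrite mus {1}h shiftN ?shiftZ//; [rewrite TK addNr|exact: domZ].
  rewrite mus => h; apply: inj; [|exact: dom0|].
    by apply: domD => //; exact: domZ.
  by rewrite shift0 shiftD ?shiftZ ?TK//; exact: domZ.
have VB x y : V (x - y) = V x - V y.
  rewrite /V -scalerBr TB [r%:C *: (T x - T y)]scalerBr; congr (_ *: _).
  by rewrite !opprD addrACA.
have Vsym x y : ip dot (V x) y = ip dot x (V y).
  by rewrite /V !ipE Tsym.
have VE x : ip dot x (V x) = 2^-1 * (rnorm x ^+ 2 - r * ip dot x (T x)).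
  by rewrite /V !ipE ipuu.
have VN x : rnorm (V x) ^+ 2 =
    4^-1 * (rnorm x ^+ 2 - 2 * r * ip dot x (T x) + r ^+ 2 * rnorm (T x) ^+ 2).
  by rewrite -(ipuu hdot) /V !ipE (ipC dot (T x) x) !ipuu//; field.
have Tr2 x : r ^+ 2 * rnorm (T x) ^+ 2 <= rnorm x ^+ 2.
  by rewrite -exprMn ler_pXn2r ?nnegrE ?mulr_ge0 ?rnorm_ge0// ltW.
have Vle x : rnorm (V x) ^+ 2 <= ip dot x (V x).
  by rewrite VE VN; have := Tr2 x; lra.
have Vgap x : 0 <= 2 * rnorm x ^+ 2 - 5 * ip dot x (V x) + 3 * rnorm (V x) ^+ 2.
  by rewrite VE VN; have := Tgap x; lra.
have V_ := iter_cvg_fixpoint VB Vsym Vle Vgap.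
split=> [x|u Du Mu].
  have [p [Vp pe _]] := V_ x; exists p; first exact/VkerE.
  move=> e Ee; apply: dot_eq0; apply: pe; apply/VkerE => //; exact: eigenspaceZ.
have [p [/VkerE Vp pe pb]] := V_ u.
have p0 : p = 0.
  have h1 : ip dot (u - p) p = 0 by apply: pe; exact/VkerE.
  have h2 : ip dot u p = 0 by rewrite /ip Mu.
  apply/eqP; rewrite -rnorm_eq0 -sqrf_eq0 -(ipuu hdot); apply/eqP.
  by move: h1; rewrite !ipE h2; lra.
have := pb p0; rewrite VE => h.
(* 1 + r T is the product of T and A - mu, so 1 - V is controlled by A - mu *)
have uE : u + r%:C *: T u = T (shift A mu%:C u).
  apply: inj => //; first by apply: domD => //; exact: domZ.
  by rewrite TK shiftD ?shiftZ ?TK ?mus//; exact: domZ.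
have h1 := ip_le hdot u (T (shift A mu%:C u)).
have h2 := Tr (shift A mu%:C u).
rewrite -uE !ipE ipuu// in h1.
have [->|u0] := eqVneq u 0; first by rewrite rnorm0 mulr0 rnorm_ge0.
have u0' : 0 < rnorm u by rewrite rnorm_gt0.
have h3 : 2 / 5 * rnorm u <= rnorm (u + r%:C *: T u).
  rewrite -(ler_pM2l u0'); lra.
rewrite uE in h3; apply: le_trans h2; rewrite -mulrA mulrCA; apply: ler_wpM2l => //.
exact: ltW.
Qed.

End Isolated.

(** * The resolvent set *)

Section Resolvent.
Variables (R : realType) (H : completeNormedModType R[i]) (dot : {dot H for Num.conj}).
Hypothesis hdot : norm_induced_by dot.
Variable A : operator H.
Hypothesis sym : forall u v, dom A u -> dom A v -> dot (A u) v = dot u (A v).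
Implicit Types (u v w : H) (z : R[i]) (a c : R).

Lemma resolvent_open z : resolvent_set A z ->
  exists2 e : R, 0 < e & forall z', normc (z' - z) < e -> resolvent_set A z'.
Proof.
move=> /(resolvent_regular dot)[c hc]; exists c; first by case: hc.
move=> z' zz'; apply/(resolvent_regular dot).
by exists (c - normc (z' - z)); exact: (regular_on_perturb hdot).
Qed.

Lemma isolated_punctured_resolvent z : isolated (spectrum A : set (R[i])^o) z ->
  exists2 e : R, 0 < e &
    forall z', z' != z -> normc (z' - z) < e -> resolvent_set A z'.
Proof.
move=> [_ [V Vz Vspec]].
move/nbhs_ballP: Vz => [e /= e0 eV].
have re0 : 0 < complex.Re e by move: e0; rewrite ltcE => /andP[].
have eE : e = (complex.Re e)%:C by rewrite RRe_real// gtr0_real.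
exists (complex.Re e) => // z' z'z ze; apply: contrapT => sz'.
have : (V `&` spectrum A) z'.
  split=> //; apply: eV; rewrite -ball_normE /= rnormE eE ltcR rnorm_complex.
  by rewrite -[X in normc X]opprB normcN.
by rewrite Vspec => /eqP; exact/negP.
Qed.

(** The number dot (A u) u is real, so the imaginary part of dot ((A - z) u) u
    comes from z alone. *)
Lemma shift_im z u : dom A u ->
  `|complex.Im z| * rnorm u <= rnorm (shift A z u).
Proof.
move=> Du; have [->|u0] := eqVneq u 0; first by rewrite rnorm0 mulr0 rnorm_ge0.
have u0' : 0 < rnorm u by rewrite rnorm_gt0.
rewrite -(ler_pM2r u0'); apply: le_trans (normc_dot_le hdot _ _).
have im : complex.Im (dot (A u) u) = 0.
  have := sym Du Du; rewrite [in RHS](dotC dot); case: (dot _ _) => a b [] /=.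
  by move/eqP; rewrite -addr_eq0 -mulr2n mulrn_eq0 => /eqP.
have -> : `|complex.Im z| * rnorm u * rnorm u = `|complex.Im (dot (shift A z u) u)|.
  rewrite /shift dotBl dotZl dotuu//; move: im; case: (dot _ _) => a b /= ->.
  case: z => x y /=; rewrite mulr0 !add0r normrN normrM (ger0_norm (sqr_ge0 _)).
  by rewrite -mulrA.
rewrite -(@ler_pXn2r _ 2%N)// ?nnegrE ?normr_ge0 ?normc_ge0//.
by rewrite normcsq real_normK ?num_real// lerDr sqr_ge0.
Qed.

Lemma nonreal_near z z' : resolvent_set A z ->
  normc (z' - z) < `|complex.Im z| -> resolvent_set A z'.
Proof.
move=> /(resolvent_regular dot)[c [c0 surj _]] zz'.
have z0 : 0 < `|complex.Im z| by apply: le_lt_trans zz'; exact: normc_ge0.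
have hreg : regular_on dot A set0 z `|complex.Im z|.
  by split=> // u Du _; exact: shift_im.
by apply/(resolvent_regular dot); eexists; exact: (regular_on_perturb hdot hreg zz').
Qed.

(** By [nonreal_near] the resolvent set spreads from x + i y to the disc of
    radius y around it.  Going up the vertical line through x0 by factors 3/2
    reaches discs that exhaust the half plane; s is the sign of the imaginary
    part. *)
Lemma halfplane_resolvent (s x0 y0 : R) : `|s| = 1 -> 0 < y0 ->
  resolvent_set A (x0 +i* (s * y0)) ->
  forall x y, 0 < y -> resolvent_set A (x +i* (s * y)).
Proof.
move=> s1 y00 r0 x y y0'.
have ss : s ^+ 2 = 1 by rewrite -real_normK ?num_real// s1 expr1n.
pose Y k : R := y0 * (1 + 2^-1) ^+ k.
have Y0 k : 0 < Y k by rewrite mulr_gt0// exprn_gt0// addr_gt0// invr_gt0.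
have rY k : resolvent_set A (x0 +i* (s * Y k)).
  elim: k => [|k IH]; first by rewrite /Y expr0 mulr1.
  apply: nonreal_near IH _.
  rewrite /= normrM s1 mul1r gtr0_norm//.
  rewrite -(@ltr_pXn2r _ 2%N)// ?nnegrE ?sqrtr_ge0 ?ltW//.
  rewrite sqr_sqrtr ?addr_ge0 ?sqr_ge0// subrr expr0n/= add0r.
  have -> : s * Y k.+1 - s * Y k = s * (2^-1 * Y k) by rewrite /Y exprS; field.
  by rewrite exprMn ss mul1r exprMn gtr_pMl ?exprn_gt0//; lra.
(* x + i s y is in the disc around x0 + i s Y of radius Y once Y exceeds b *)
pose b := ((x - x0) ^+ 2 + y ^+ 2) / (2 * y).
have [k hk] : exists k, b < Y k.
  have b0 : 0 <= b by rewrite divr_ge0 ?addr_ge0 ?sqr_ge0 ?mulr_ge0// ltW.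
  pose k := Num.bound (2 * b / y0).
  exists k; have : 2 * b / y0 < k%:R.
    by apply: archi_boundP; apply: divr_ge0; [exact: mulr_ge0|exact: ltW].
  rewrite ltr_pdivrMr// => hk.
  have bern : 1 + k%:R / 2 <= (1 + 2^-1 : R) ^+ k.
    elim: (k) => [|j IH]; first by rewrite mul0r addr0 expr0.
    rewrite exprS -natr1; have : 0 <= j%:R :> R by []. 
    nra.
  have : (1 + k%:R / 2) * y0 <= Y k by rewrite /Y mulrC ler_pM2l.
  nra.
apply: nonreal_near (rY k) _.
rewrite /= normrM s1 mul1r gtr0_norm//.
rewrite -(@ltr_pXn2r _ 2%N)// ?nnegrE ?sqrtr_ge0 ?ltW//.
rewrite sqr_sqrtr ?addr_ge0 ?sqr_ge0// -mulrBr exprMn ss mul1r.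
move: hk; rewrite /b ltr_pdivrMr ?mulr_gt0//; nra.
Qed.

Lemma nonreal_resolvent (l e : R) : 0 < e ->
  (forall z, z != l%:C -> normc (z - l%:C) < e -> resolvent_set A z) ->
  forall z, complex.Im z != 0 -> resolvent_set A z.
Proof.
move=> e0 he.
have he' (s : R) : `|s| = 1 -> resolvent_set A (l +i* (s * (e / 2))).
  move=> s1; have s0 : s != 0 by rewrite -normr_eq0 s1 oner_eq0.
  apply: he.
    apply/eqP => -[] /eqP; rewrite mulf_eq0 (negPf s0)/= gt_eqF//.
    by rewrite divr_gt0.
  rewrite /= subr0 subrr expr0n/= add0r sqrtr_sqr normrM s1 mul1r.
  by rewrite gtr0_norm ?divr_gt0//; lra.
have e2 : 0 < e / 2 by rewrite divr_gt0.
move=> [x y] /= y0; have [y_gt|y_lt] : 0 < y \/ 0 < - y.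
    by move: y0; rewrite neq_lt oppr_gt0 => /orP[]; [right|left].
  rewrite -[y]mul1r; have s1 : `|1 : R| = 1 by rewrite normr1.
  by apply: (halfplane_resolvent s1 e2 (he' _ s1)).
have -> : y = -1 * - y by rewrite mulN1r opprK.
have s1 : `|- 1 : R| = 1 by rewrite normrN normr1.
by apply: (halfplane_resolvent s1 e2 (he' _ s1)).
Qed.

End Resolvent.

(** * Finite-dimensional subspaces and min-max numbers *)

Section Span.
Variables (R : realType) (H : normedModType R[i]).
Implicit Types (u v w : H) (z : R[i]).

Lemma lin_spanP k (v : 'I_k -> H) z u w :
  lin_span v u -> lin_span v w -> lin_span v (z *: u + w).
Proof.
move=> [c ->] [d ->]; exists (fun i => z * c i + d i).
rewrite scaler_sumr -big_split; apply: eq_bigr => i _.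
by rewrite scalerDl scalerA.
Qed.

Lemma lin_span0 k (v : 'I_k -> H) : lin_span v 0.
Proof. by exists (fun=> 0); rewrite big1// => i _; rewrite scale0r. Qed.

Lemma lin_spanZ k (v : 'I_k -> H) z u : lin_span v u -> lin_span v (z *: u).
Proof. by move=> hu; rewrite -[_ *: _]addr0; apply: lin_spanP => //; exact: lin_span0. Qed.

Lemma lin_spanD k (v : 'I_k -> H) u w : lin_span v u -> lin_span v w -> lin_span v (u + w).
Proof. by move=> hu hw; rewrite -[u]scale1r; exact: lin_spanP. Qed.

Lemma mem_lin_span k (v : 'I_k -> H) i : lin_span v (v i).
Proof.
exists (fun j => (i == j)%:R); rewrite (bigD1 i)//= eqxx scale1r big1 ?addr0// => j ji.
by rewrite eq_sym (negPf ji) scale0r.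
Qed.

Lemma lin_span_sub k l (v : 'I_k -> H) (w : 'I_l -> H) :
  (forall i, lin_span w (v i)) -> lin_span v `<=` lin_span w.
Proof.
move=> vw _ [c ->]; elim/big_ind: _ => //; first exact: lin_span0.
- by move=> x y; exact: lin_spanD.
- by move=> i _; exact: lin_spanZ.
Qed.

Lemma lin_span_recr k (v : 'I_k.+1 -> H) u : lin_span v u ->
  exists2 a, lin_span (fun i => v (widen_ord (leqnSn k) i)) a &
    exists z, u = a + z *: v ord_max.
Proof.
move=> [c ->]; rewrite big_ord_recr /=; eexists; last by exists (c ord_max).
by exists (fun i => c (widen_ord (leqnSn k) i)).
Qed.

Lemma lin_span_recr_sub k (v : 'I_k.+1 -> H) q u :
  lin_span (fun i => v (widen_ord (leqnSn k) i)) q -> lin_span v u ->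
  exists2 a, lin_span (fun i => v (widen_ord (leqnSn k) i)) a &
    exists z, u = a + z *: (v ord_max - q).
Proof.
move=> vq /lin_span_recr[a va [z ->]]; exists (z *: q + a); first exact: lin_spanP.
by exists z; rewrite scalerBr [RHS]addrC addrA subrK addrC.
Qed.

Lemma lin_indep_widen k l (kl : (k <= l)%N) (v : 'I_l -> H) :
  lin_indep v -> lin_indep (fun i => v (widen_ord kl i)).
Proof.
move=> vi c hc i.
pose d (j : 'I_l) : R[i] := if insub (val j) is Some i then c i else 0.
have dw j : d (widen_ord kl j) = c j by rewrite /d /= valK.
rewrite -dw; apply: vi; rewrite -[RHS]hc.
rewrite (bigID (fun j : 'I_l => (j < k)%N))/= [X in _ + X]big1 ?addr0; last first.
  by move=> j /negPf jk; rewrite /d insubF ?scale0r.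
rewrite (big_ord_narrow kl); apply: eq_bigr => j _.
by rewrite dw.
Qed.

Lemma lin_indep_neq0 k (v : 'I_k -> H) i : lin_indep v -> v i != 0.
Proof.
move=> vi; apply/eqP => v0; have := vi (fun j => (i == j)%:R) _ i; rewrite eqxx.
move=> h; suff /eqP : (1 : R[i]) = 0 by rewrite oner_eq0.
apply: h; rewrite (bigD1 i)//= v0 scaler0 add0r big1// => j ji.
by rewrite eq_sym (negPf ji) scale0r.
Qed.

End Span.

Section Minimax.
Variables (R : realType) (H : normedModType R[i]) (dot : {dot H for Num.conj}).
Hypothesis hdot : norm_induced_by dot.
Variables (A : operator H) (t : R).
Implicit Types (u v w : H) (z : R[i]) (W : set H).

(** By induction on k, one Gram-Schmidt step at a time: the last vector of v is
    replaced by its component w orthogonal to the others, which may vanish. *)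
Lemma span_projection k (v : 'I_k -> H) x :
  exists2 p, lin_span v p & forall y, lin_span v y -> dot (x - p) y = 0.
Proof.
elim: k v x => [|k IH] v x.
  exists 0; first exact: lin_span0.
  by move=> _ [c ->]; rewrite big_ord0 dot0r.
set v' := fun i => v (widen_ord (leqnSn k) i).
have sub : lin_span v' `<=` lin_span v by apply: lin_span_sub => i; exact: mem_lin_span.
have [p vp pv] := IH v' x; have [q vq qv] := IH v' (v ord_max).
set w := v ord_max - q in qv.
have decomp y : lin_span v y -> exists2 a, lin_span v' a & exists z, y = a + z *: w.
  exact: lin_span_recr_sub.
have vw : lin_span v w.
  rewrite /w addrC -scaleN1r; apply: lin_spanP; [exact: sub|exact: mem_lin_span].
have [w0|w0] := eqVneq w 0.
  exists p; first exact: sub.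
  by move=> y /decomp[a va [z ->]]; rewrite w0 scaler0 addr0; exact: pv.
have ww : dot w w != 0.
  rewrite dotuu//; apply/eqP => -[] /eqP; rewrite sqrf_eq0 rnorm_eq0.
  exact/negP.
exists ((dot x w / dot w w) *: w + p); first by apply: lin_spanP => //; exact: sub.
move=> y /decomp[a va [z ->]].
have pw : dot p w = 0 by apply: dot_eq0C; exact: qv.
clearbody w; set c := _ / _.
have E b : dot (x - (c *: w + p)) b = dot (x - p) b - c * dot w b.
  by rewrite !dotBl dotDl dotZl; ring.
rewrite dotDr dotZr !E pv// qv// mulr0 subrr add0r dotBl pw subr0.
by rewrite /c divfK// subrr mulr0.
Qed.

(** The suprema in [minimax] are bounded, hence monotone in the test space; the
    supremum of an unbounded set would be 0. *)
Lemma shift_bounded_on_span k (v : 'I_k -> H) : (forall i, dom A (v i)) ->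
  exists2 C : R, 0 <= C & forall u, lin_span v u -> seminorm A t u <= C * rnorm u.
Proof.
elim: k v => [|k IH] v Dv.
  exists 0 => // _ [c ->]; rewrite big_ord0 mul0r /seminorm -/(shift A t%:C 0).
  by rewrite shift0 rnorm0.
set v' := fun i => v (widen_ord (leqnSn k) i).
have [C C0 hC] := IH v' (fun i => Dv _).
have [q vq qv] := span_projection v' (v ord_max).
set w := v ord_max - q in qv.
have Ds y : lin_span v' y -> dom A y.
  by move=> [c ->]; apply: dom_sum => i _; apply: domZ; exact: Dv.
have Dw : dom A w by apply: domB => //; exact: Ds.
have decomp y : lin_span v y -> exists2 a, lin_span v' a & exists z, y = a + z *: w.
  exact: lin_span_recr_sub.
have B0 : 0 <= seminorm A t w / rnorm w by rewrite divr_ge0 ?rnorm_ge0.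
exists (C + seminorm A t w / rnorm w); first exact: addr_ge0.
move=> u /decomp[a va [z ->]].
have pyth : rnorm (a + z *: w) ^+ 2 = rnorm a ^+ 2 + rnorm (z *: w) ^+ 2.
  by apply: (rnormD_sq hdot); apply: dot_eq0C; rewrite dotZl qv// mulr0.
have le1 : rnorm a <= rnorm (a + z *: w).
  by rewrite -(@ler_pXn2r _ 2%N)// ?nnegrE ?rnorm_ge0// pyth lerDl sqr_ge0.
have le2 : rnorm (z *: w) <= rnorm (a + z *: w).
  by rewrite -(@ler_pXn2r _ 2%N)// ?nnegrE ?rnorm_ge0// pyth lerDr sqr_ge0.
rewrite /seminorm -/(shift A t%:C _) shiftD ?shiftZ//; [|exact: Ds|exact: domZ].
apply: le_trans (rnormD _ _) _; rewrite mulrDl; apply: lerD.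
  by apply: le_trans (hC _ va) _; exact: ler_wpM2l.
have [w0|w0] := eqVneq w 0.
  by rewrite w0 shift0 scaler0 rnorm0 mulr_ge0 ?rnorm_ge0 ?divr_ge0 ?rnorm_ge0.
apply: (@le_trans _ _ (seminorm A t w / rnorm w * rnorm (z *: w))).
  by rewrite !rnormZ mulrCA divfK// rnorm_eq0.
exact: ler_wpM2l.
Qed.

Definition rayleigh (V : set H) := [set seminorm A t u / rnorm u | u in V `\ 0].

Lemma rayleigh_ge0 V r : rayleigh V r -> 0 <= r.
Proof. by move=> [u _ <-]; rewrite divr_ge0 ?rnorm_ge0. Qed.

Lemma sup_rayleigh_ge0 V : 0 <= sup (rayleigh V).
Proof.
have [hs|/sup_out -> //] := pselect (has_sup (rayleigh V)).
by case: (hs) => -[r Vr] hu; apply: le_trans (rayleigh_ge0 Vr) _; exact: ub_le_sup.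
Qed.

Definition testspace W j := [set V : set H | has_dim V j /\ V `<=` W].

Lemma minimaxE W j :
  minimax A t W j = inf [set sup (rayleigh V) | V in testspace W j].
Proof. by []. Qed.

Lemma minimax_le W j V : testspace W j V -> minimax A t W j <= sup (rayleigh V).
Proof.
move=> hV; apply: ge_inf; last by exists V.
by exists 0 => _ [U _ <-]; exact: sup_rayleigh_ge0.
Qed.

Lemma le_minimax W j r : testspace W j !=set0 ->
  (forall V, testspace W j V -> r <= sup (rayleigh V)) -> r <= minimax A t W j.
Proof.
move=> [V hV] h; apply: lb_le_inf; first by exists (sup (rayleigh V)); exists V.
by move=> _ [U hU <-]; exact: h.
Qed.

Lemma minimax_ge0 W j : 0 <= minimax A t W j.
Proof.
have [h|h] := pselect (testspace W j !=set0).
  by apply: le_minimax => // V _; exact: sup_rayleigh_ge0.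
rewrite minimaxE; have -> : [set sup (rayleigh V) | V in testspace W j] = set0.
  by apply/seteqP; split=> // r [V hV _]; apply: h; exists V.
by rewrite inf0.
Qed.

Lemma testspace_widen W k j V : (k <= j)%N -> testspace W j V ->
  exists2 V', testspace W k V' & V' `<=` V.
Proof.
move=> kj [[v vi ->] VW].
have sub : lin_span (fun i => v (widen_ord kj i)) `<=` lin_span v.
  by apply: lin_span_sub => i; exact: mem_lin_span.
exists (lin_span (fun i => v (widen_ord kj i))) => //; split.
  by eexists; [exact: lin_indep_widen vi|].
by move=> x /sub; exact: VW.
Qed.

Lemma minimax_mono W k j : W `<=` dom A -> (0 < k <= j)%N ->
  testspace W j !=set0 -> minimax A t W k <= minimax A t W j.
Proof.
move=> WD /andP[k0 kj] ne; apply: le_minimax => // V hV.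
have [V' hV' V'V] := testspace_widen kj hV.
apply: le_trans (minimax_le hV') _.
case: hV => -[v vi VE] VW; case: hV' => -[v' vi' V'E] _.
have Dv i : dom A (v i) by apply/WD/VW; rewrite VE; exact: mem_lin_span.
have [C C0 hC] := shift_bounded_on_span Dv.
have Vub : has_ubound (rayleigh V).
  exists C => _ [u [Vu /eqP u0] <-]; rewrite ler_pdivrMr ?rnorm_gt0//.
  by apply: hC; rewrite -VE.
apply: ge_sup.
  pose o := Ordinal k0; exists (seminorm A t (v' o) / rnorm (v' o)).
  exists (v' o) => //; split; first by rewrite V'E; exact: mem_lin_span.
  by apply/eqP; exact: lin_indep_neq0.
move=> _ [u [Vu u0] <-]; apply: ub_le_sup => //; exists u => //; split=> //.
exact: V'V.
Qed.

(** The weak form of (A - t) ^ 2 u = d ^ 2 u.  It holds for the eigenvectors at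
    t + d and at t - d alike and for their sums, asks for no more than u in the
    domain of A, and is all that the orthogonality relations need. *)
Definition sq_eigen (d : R) u := dom A u /\
  forall x, dom A x ->
    dot (shift A t%:C u) (shift A t%:C x) = (d ^+ 2)%:C * dot u x.

Lemma sq_eigenD d u v : sq_eigen d u -> sq_eigen d v -> sq_eigen d (u + v).
Proof.
move=> [Du hu] [Dv hv]; split=> [|x Dx]; first exact: domD.
by rewrite shiftD// (dotDl dot (shift _ _ _)) (dotDl dot u) hu// hv// mulrDr.
Qed.

Lemma sq_eigenZ d z u : sq_eigen d u -> sq_eigen d (z *: u).
Proof.
move=> [Du hu]; split=> [|x Dx]; first exact: domZ.
by rewrite shiftZ// !dotZl hu// mulrCA.
Qed.

Lemma sq_eigen_orth d d' u v : sq_eigen d u -> sq_eigen d' v ->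
  d ^+ 2 != d' ^+ 2 -> dot u v = 0.
Proof.
move=> [Du hu] [Dv hv] dd'; have e1 := hu _ Dv; have := hv _ Du.
rewrite (dotC dot (shift _ _ v)) e1 rmorphM/= conj_real -(dotC dot v u) => /eqP.
rewrite -subr_eq0 -mulrBl mulf_eq0 subr_eq0 => /orP[/eqP/complexI/eqP|/eqP].
  by rewrite (negPf dd').
exact: dot_eq0C.
Qed.

Lemma normc_conj z : z * z^* = (normc z ^+ 2)%:C.
Proof.
rewrite normcsq; case: z => a b; apply/eqP; rewrite eq_complex /=. 
apply/andP; split; apply/eqP; ring.
Qed.

Lemma specdist_le_of_orthonormal k (f : 'I_k.+1 -> H) (d : 'I_k.+1 -> R) (r : R) :
  orthonormal_family dot f -> (forall i, sq_eigen (d i) (f i)) ->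
  (forall i, 0 <= d i <= r) -> specdist A t k.+1 <= r.
Proof.
move=> fo fd dr.
have Df i : dom A (f i) by case: (fd i).
have r0 : 0 <= r by case/andP: (dr ord0) => h1 h2; exact: le_trans h2.
have dotf c i : dot (\sum_j c j *: f j) (f i) = c i.
  rewrite dot_suml (bigD1 i)//= dotZl fo eqxx mulr1 big1 ?addr0// => j ji.
  by rewrite dotZl fo (negPf ji) mulr0.
have fi : lin_indep f by move=> c hc i; rewrite -(dotf c) hc dot0l.
have ts : testspace (dom A) k.+1 (lin_span f).
  split; first by exists f.
  by move=> _ [c ->]; apply: dom_sum => i _; exact: domZ.
apply: le_trans (minimax_le ts) _; apply: ge_sup.
  exists (seminorm A t (f ord0) / rnorm (f ord0)); exists (f ord0) => //.
  by split; [exact: mem_lin_span|apply/eqP; exact: lin_indep_neq0].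
move=> _ [u [[c uE] /eqP u0] <-]; rewrite ler_pdivrMr ?rnorm_gt0//.
have Du : dom A u by rewrite uE; apply: dom_sum => i _; exact: domZ.
have dotfu i : dot (f i) u = (c i)^* by rewrite dotC uE dotf.
have E1 : rnorm u ^+ 2 = \sum_i normc (c i) ^+ 2.
  apply: complexI; rewrite -(dotuu hdot) {1}uE dot_suml rmorph_sum/=.
  by apply: eq_bigr => i _; rewrite dotZl dotfu normc_conj.
have E2 : seminorm A t u ^+ 2 = \sum_i d i ^+ 2 * normc (c i) ^+ 2.
  apply: complexI; rewrite -(dotuu hdot) -/(shift A t%:C u) {1}uE.
  rewrite shift_sum ?dot_suml ?rmorph_sum/=; last by move=> i; exact: domZ.
  apply: eq_bigr => i _; rewrite shiftZ// dotZl; case: (fd i) => _ ->//.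
  by rewrite dotfu mulrCA normc_conj -rmorphM.
rewrite -(@ler_pXn2r _ 2%N)// ?nnegrE ?mulr_ge0 ?rnorm_ge0//.
rewrite exprMn E1 E2 mulr_sumr; apply: ler_sum => i _.
apply: ler_wpM2r; first exact: sqr_ge0.
by case/andP: (dr i) => d0 dr'; rewrite ler_pXn2r.
Qed.

End Minimax.

(** * Splitting off a pair of eigenspaces *)

Section Punctured.
Variables (R : realType) (H : completeNormedModType R[i]) (dot : {dot H for Num.conj}).
Hypothesis hdot : norm_induced_by dot.
Variable A : operator H.
Hypothesis sym : forall u v, dom A u -> dom A v -> dot (A u) v = dot u (A v).
Implicit Types (u v w : H) (z : R[i]) (l a c d t : R).

(** Regular points qualify as well as isolated points of the spectrum, so t + d_j
    and t - d_j need no distinction between the two. *)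
Definition punctured_regular l := exists2 e : R, 0 < e &
  forall z, z != l%:C -> normc (z - l%:C) < e -> resolvent_set A z.

Lemma punctured_regular_split l : punctured_regular l -> exists2 b : R, 0 < b &
  (forall x, exists2 p, eigenspace A l%:C p & ortho_eigen dot A l (x - p)) /\
  (forall u, dom A u -> ortho_eigen dot A l u ->
     b * rnorm u <= rnorm (shift A l%:C u)).
Proof.
move=> [e e0 he].
have e2 : 0 < e / 2 by rewrite divr_gt0.
have := @punctured_split _ _ _ hdot _ sym l (e / 2) e2; case.
  move=> x /andP[xl xe]; apply: he.
    by apply: contraTneq xl => /complexI ->; rewrite subrr normr0 ltxx.
  by rewrite -rmorphB normcR/=; lra.
move=> hp hb; exists (2 / 5 * (e / 2)); first by lra.
by split.
Qed.

(** A - l is bounded below on the complement of S by [punctured_split], and it is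
    onto because it is close to A - (l + eta), which is regular there. *)
Lemma punctured_regular_on S l : real_eigenvectors A S -> punctured_regular l ->
  eigenspace A l%:C `<=` S -> exists c, regular_on dot A S l%:C c.
Proof.
move=> hS iso lS; have [b b0 [_ hb]] := punctured_regular_split iso.
case: iso => e e0 he.
(* eta < e keeps l + eta regular; 2 eta < b leaves room for the perturbation *)
pose eta := Num.min (e / 2) (b / 4).
have eta0 : 0 < eta by rewrite lt_min !divr_gt0.
have [eta_e eta_b] : eta <= e / 2 /\ eta <= b / 4.
  by split; rewrite ge_min lexx ?orbT.
have eE : normc ((l + eta)%:C - l%:C) = eta.
  by rewrite -rmorphB addrAC subrr add0r normcR gtr0_norm.
have rz : resolvent_set A (l + eta)%:C.
  apply: he; last by rewrite eE; lra.
  by apply/eqP => /complexI; lra.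
have [c [c0 surj _]] := regular_orth sym hS rz.
have reg : regular_on dot A S (l + eta)%:C (b - eta).
  split=> //; first by lra.
  move=> u Du Mu; rewrite mulrBl lerBlDr.
  have := hb u Du _; rewrite /ortho_eigen => /(_ (fun e Ee => Mu e (lS e Ee))) h.
  apply: le_trans h _; rewrite (shift_change _ (l + eta)%:C).
  by apply: le_trans (rnormD _ _) _; rewrite rnormZ eE.
exists (b - eta - normc (l%:C - (l + eta)%:C)); apply: (regular_on_perturb hdot reg).
by rewrite -normcN opprB eE; lra.
Qed.

Lemma resolvent_punctured_regular l : resolvent_set A l%:C -> punctured_regular l.
Proof. by move=> /(resolvent_open hdot)[e e0 he]; exists e => // z _; exact: he. Qed.

Definition pm_eigen t d u := exists p q,
  [/\ eigenspace A (t + d)%:C p, eigenspace A (t - d)%:C q & u = p + q].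

Lemma eigen_sq_eigen t d l u : eigenspace A l%:C u -> (l - t) ^+ 2 = d ^+ 2 ->
  sq_eigen dot A t d u.
Proof.
move=> ul ld; have [Du _] := ul; split=> // x Dx.
by rewrite -shiftR_sym ?(shift_eigen _ ul) ?shiftZ ?(shift_eigen _ ul)//;
   [rewrite scalerA dotZl -ld expr2 rmorphM rmorphB|exact: domZ].
Qed.

Lemma pm_eigen_sq t d u : pm_eigen t d u -> sq_eigen dot A t d u.
Proof.
move=> [p [q [hp hq ->]]]; apply: sq_eigenD.
  by apply: eigen_sq_eigen hp _; ring.
by apply: eigen_sq_eigen hq _; ring.
Qed.

Lemma pm_eigenZ t d z u : pm_eigen t d u -> pm_eigen t d (z *: u).
Proof.
move=> [p [q [hp hq ->]]]; exists (z *: p), (z *: q); rewrite scalerDr.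
by split=> //; exact: eigenspaceZ.
Qed.

Lemma pm_eigen_sum t d I u : I (t + d) -> I (t - d) -> pm_eigen t d u -> eigensum A I u.
Proof.
move=> Ip Im [p [q [hp hq ->]]].
exists 2%N, (fun i => if i == ord0 then t + d else t - d),
  (fun i => if i == ord0 then p else q); split; last by rewrite !big_ord_recr big_ord0/= add0r.
by move=> i; case: eqP.
Qed.

Lemma eigen_orth l l' u v : eigenspace A l%:C u -> eigenspace A l'%:C v -> l != l' ->
  dot u v = 0.
Proof.
move=> ul vl ll'; have [Du _] := ul; have [Dv _] := vl.
have := shiftR_sym sym l Du Dv.
rewrite (shift_eigen _ ul) (shift_eigen _ vl) subrr scale0r dot0l dotZr.
move=> /esym/eqP; rewrite -rmorphB/= conj_real mulf_eq0 => /orP[/eqP/complexI/eqP|/eqP//].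
by rewrite subr_eq0 eq_sym (negPf ll').
Qed.

(** Project x onto the eigenspace at t + d, then the rest onto the one at t - d.
    The second projection does not spoil the first: the eigenspaces are
    orthogonal or, when d = 0, equal. *)
Lemma pm_eigen_split t d x : punctured_regular (t + d) -> punctured_regular (t - d) ->
  exists2 y, pm_eigen t d y &
    ortho_eigen dot A (t + d) (x - y) /\ ortho_eigen dot A (t - d) (x - y).
Proof.
move=> /punctured_regular_split[_ _ [prp _]] /punctured_regular_split[_ _ [prm _]].
have [p hp px] := prp x; have [q hq qx] := prm (x - p).
exists (p + q); first by exists p, q.
rewrite opprD addrA; split=> // e Ee.
have [d0|d0] := eqVneq d 0.
  by apply: qx; rewrite d0 subr0; move: Ee; rewrite d0 addr0.
rewrite dotBl px// (eigen_orth hq Ee) ?subrr//.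
by rewrite (inj_eq (addrI t)) -subr_eq0 -opprD oppr_eq0 -mulr2n mulrn_eq0.
Qed.

End Punctured.

(** * The spectral gap *)

Section SpectralGap.
Variables (R : realType) (H : completeNormedModType R[i]) (dot : {dot H for Num.conj}).
Hypothesis hdot : norm_induced_by dot.
Variable A : operator H.
Hypothesis sym : forall u v, dom A u -> dom A v -> dot (A u) v = dot u (A v).
Variables (t : R) (m : nat).
Hypothesis ne : testspace (dom A) m !=set0.
Local Notation d k := (specdist A t k).
Hypothesis hdisc : [set s%:C | s in `[t - d m, t + d m]]
             `&` spectrum A `<=` disc_spectrum A.
Implicit Types (u v w : H) (z : R[i]) (a c : R) (j : 'I_m) (phi : 'I_m -> H).

Lemma specdist_ge0 k : 0 <= d k.
Proof. exact: minimax_ge0. Qed.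

Lemma specdist_mono i k : (0 < i <= k)%N -> (k <= m)%N -> d i <= d k.
Proof.
move=> ik km; apply: (minimax_mono hdot) => //.
by case: ne => V /(testspace_widen km)[V' hV' _]; exists V'.
Qed.

Lemma near_punctured_regular (l : R) : `|l - t| <= d m -> punctured_regular A l.
Proof.
rewrite ler_distl => lt.
have [rl|rl] := pselect (resolvent_set A l%:C).
  exact: (resolvent_punctured_regular hdot rl).
have [iso _] : disc_spectrum A l%:C.
  by apply: hdisc; split=> //; exists l => //=; rewrite in_itv.
exact: isolated_punctured_resolvent iso.
Qed.

Lemma near_eigenvalue (l : R) : `|l - t| <= d m -> ~ resolvent_set A l%:C ->
  exists2 v, v != 0 & eigenspace A l%:C v.
Proof.
rewrite ler_distl => lt rl.
have [_ [k k0 [v vi vE]]] : disc_spectrum A l%:C.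
  by apply: hdisc; split=> //; exists l => //=; rewrite in_itv.
pose o := Ordinal k0.
by exists (v o); [exact: lin_indep_neq0|rewrite vE; exact: mem_lin_span].
Qed.

Definition orthonormal_below j phi :=
  forall i k : 'I_m, (i < j)%N -> (k < j)%N -> dot (phi i) (phi k) = (i == k)%:R.

Definition adapted_below j phi :=
  forall k : 'I_m, (k < j)%N -> pm_eigen A t (d k.+1) (phi k).

(** Let l be least with d_(l+1) >= d_j.  If v were nonzero, phi_1, ..., phi_l and
    v would span a test space of dimension l + 1 on which |B u| / |u| is at most
    the larger of r and d_l, hence less than d_j. *)
Lemma sq_eigen_exhausted j phi r v :
  orthonormal_below j phi -> adapted_below j phi ->
  0 <= r < d j.+1 -> sq_eigen dot A t r v ->
  (forall k : 'I_m, (k < j)%N -> dot v (phi k) = 0) -> v = 0.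
Proof.
move=> ho ha /andP[r0 rj] hv vphi; apply/eqP/negPn/negP => v0.
have [|l hl lmin] := @ex_minnP (fun l => d j.+1 <= d l.+1).
  by exists j.
have lj : (l <= j)%N by exact: lmin.
have below i : (i < l)%N -> d i.+1 < d j.+1.
  by move=> il; rewrite ltNge; apply/negP => /lmin; rewrite leqNgt il.
pose x i := insubd j i.
have xE i : (i < l)%N -> val (x i) = i.
  by move=> il; rewrite insubdK// unfold_in (leq_trans il)// (leq_trans lj)// ltnW.
have xj i : (i < l)%N -> (x i < j)%N.
  by move=> il; rewrite xE// (leq_trans il).
pose v1 := (rnorm v)^-1%:C *: v.
have v11 : dot v1 v1 = 1.
  rewrite dotZl dotZr conj_real dotuu// mulrA -!rmorphM/= expr2.
  by rewrite mulrACA !mulVf ?rnorm_eq0// mulr1.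
have v1phi i : (i < l)%N -> dot v1 (phi (x i)) = 0.
  by move=> il; rewrite dotZl vphi ?mulr0// xj.
pose f (i : 'I_l.+1) := if (i < l)%N then phi (x i) else v1.
pose e (i : 'I_l.+1) := if (i < l)%N then d i.+1 else r.
pose r' := Num.max r (if (0 < l)%N then d l else 0).
have : d l.+1 <= r'.
  apply: (@specdist_le_of_orthonormal _ _ _ hdot A t l f e).
  - move=> i k; rewrite /f; have [il|li] := ltnP i l; have [kl|lk] := ltnP k l.
    + rewrite ho ?xj//; congr (_ %:R); congr nat_of_bool.
      by rewrite -!val_eqE /= !xE.
    + rewrite dot_eq0C ?v1phi//; case: eqP => // ik.
      by move: lk; rewrite -ik leqNgt il.
    + rewrite v1phi//; case: eqP => // ik.
      by move: li; rewrite ik leqNgt kl.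
    + have il (o : 'I_l.+1) : (l <= o)%N -> val o = l.
        by move=> lo; apply/eqP; rewrite eqn_leq lo andbT -ltnS ltn_ord.
      have -> : i = k by apply: val_inj; rewrite (il _ li) (il _ lk).
      by rewrite eqxx v11.
  - move=> i; rewrite /f /e; have [il|li] := ltnP i l; last exact: sq_eigenZ.
    by rewrite -[in d _](xE i il); apply: pm_eigen_sq => //; apply: ha; exact: xj.
  - move=> i; rewrite /e /r'; have [il|li] := ltnP i l; last first.
      by rewrite r0 le_max lexx.
    rewrite specdist_ge0/= le_max; apply/orP; right.
    rewrite (leq_ltn_trans _ il)//; apply: specdist_mono => //.
    by rewrite (leq_trans lj)// ltnW.
move=> dr; have := le_trans hl dr; apply/negP; rewrite -ltNge gt_max rj/=.
case: ifPn => [l0|_]; last exact: le_lt_trans rj.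
by rewrite -(prednK l0); apply: below; rewrite prednK.
Qed.

Definition removed_eigenvectors j : set H := [set e | exists k : 'I_m, (k <= j)%N /\
  (eigenspace A (t + d k.+1)%:C e \/ eigenspace A (t - d k.+1)%:C e)].

Lemma removed_real_eigenvectors j : real_eigenvectors A (removed_eigenvectors j).
Proof. move=> e [k [_ [ek|ek]]]; first by exists (t + d k.+1).
by exists (t - d k.+1). Qed.

Lemma specdist_le_last j : d j.+1 <= d m.
Proof. by apply: specdist_mono => //=. Qed.

Lemma dist_plus_minus (l s : R) : 0 <= s -> (l = t + s \/ l = t - s) -> `|l - t| = s.
Proof.
by move=> s0 [] ->; rewrite addrAC subrr add0r ?normrN ger0_norm.
Qed.

(** On the complement of the removed eigenvectors, t + c and t - c are regular for
    every c below delta_j: such a point is in the resolvent set, or is one of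
    the t + d_k, t - d_k, whose eigenvectors have been removed. *)
Lemma specgap_bound j w : dom A w -> orth dot (removed_eigenvectors j) w -> w != 0 ->
  (specgap A t j.+1 <= (rnorm (shift A t%:C w) / rnorm w)%:E)%E.
Proof.
move=> Dw Mw w0; rewrite leNgt; apply/negP.
set g := _ / _ => gs.
have [g' gg' gs'] : exists2 g', g < g' & (g'%:E <= specgap A t j.+1)%E.
  case: (specgap A t j.+1) gs => [D||]//; last by move=> _; exists (g + 1); rewrite ?ltrDl ?leey.
  by rewrite lte_fin => gD; exists D.
have w0' : 0 < rnorm w by rewrite rnorm_gt0.
suff : g' * rnorm w <= rnorm (shift A t%:C w).
  by rewrite -ler_pdivlMr// -/g leNgt gg'.
apply: (regular_gap hdot sym (S := removed_eigenvectors j)) => // c /andP[c0 cg].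
have reg l : l = t + c \/ l = t - c -> exists c', regular_on dot A (removed_eigenvectors j) l%:C c'.
  move=> lE; have lc : `|l - t| = c by exact: dist_plus_minus.
  have [rl|rl] := pselect (resolvent_set A l%:C).
    exact: regular_orth (@removed_real_eigenvectors j) rl.
  have [[k /andP[k0 kj] kE]|nk] := pselect (exists2 k, (0 < k <= j.+1)%N &
       l%:C = (t + d k)%:C \/ l%:C = (t - d k)%:C).
    case: k k0 kj kE => // k _ kj kE.
    have km : (k < m)%N by rewrite (leq_trans kj).
    have kE' : l = t + d k.+1 \/ l = t - d k.+1.
      by case: kE => /complexI; [left|right].
    apply: (punctured_regular_on hdot sym (@removed_real_eigenvectors j)).
      apply: near_punctured_regular; rewrite (dist_plus_minus (specdist_ge0 k.+1))//.
      exact: (specdist_le_last (Ordinal km)).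
    move=> e Ee; exists (Ordinal km); split=> //.
    by case: kE' => lk; [left|right]; rewrite /= -lk.
  have : (specgap A t j.+1 <= c%:E)%E.
    apply: ereal_inf_lbound; exists l%:C; last first.
      by rewrite -rmorphB rnorm_complex normcR lc.
    by split.
  by move=> /(le_trans gs'); rewrite lee_fin leNgt cg.
by split; apply: reg; [left|right].
Qed.

(** Points of the spectrum closer to t than d_j are eigenvalues, which
    [sq_eigen_exhausted] identifies with some t + d_k or t - d_k.  Those farther
    than d_j keep a distance because t + d_j and t - d_j have punctured
    neighbourhoods in the resolvent set; the latter also exclude nonreal points
    of the spectrum, by [nonreal_resolvent]. *)
Lemma specdist_lt_specgap j phi : orthonormal_below j phi -> adapted_below j phi ->
  ((d j.+1)%:E < specgap A t j.+1)%E.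
Proof.
move=> ho ha.
have d0 := specdist_ge0 j.+1; have dm := specdist_le_last j.
have [|e1 e10 he1] := @near_punctured_regular (t + d j.+1).
  by rewrite (dist_plus_minus d0)//; left.
have [|e2 e20 he2] := @near_punctured_regular (t - d j.+1).
  by rewrite (dist_plus_minus d0)//; right.
pose e := Num.min e1 e2.
have e0 : 0 < e by rewrite lt_min e10.
have [ee1 ee2] : e <= e1 /\ e <= e2 by split; rewrite ge_min lexx ?orbT.
apply: (@lt_le_trans _ _ (d j.+1 + e)%:E); first by rewrite lte_fin ltrDl.
apply: le_ereal_inf_tmp => _ [z [sz nz] <-]; rewrite lee_fin rnorm_complex.
have [z0|z0] := eqVneq (complex.Im z) 0; last first.
  by exfalso; apply: sz; exact: (nonreal_resolvent hdot sym e10 he1).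
case: z z0 sz nz => l b /= -> {b}; rewrite complexr0 => sz nz.
rewrite subr0 expr0n/= addr0 sqrtr_sqr leNgt; apply/negP => lte.
have nlE : ~ (l = t + d j.+1 \/ l = t - d j.+1).
  by move=> lE; apply: nz; exists j.+1; rewrite ?leqnn//; case: lE => ->; [left|right].
have [ltd|dlt] := ltP `|l - t| (d j.+1).
  have [|v v0 vE] := near_eigenvalue (l := l) _ sz; first exact/ltW/(lt_le_trans ltd).
  have vsq : sq_eigen dot A t `|l - t| v.
    by apply: (eigen_sq_eigen sym vE); rewrite real_normK ?num_real.
  move/eqP: v0; apply; apply: (sq_eigen_exhausted ho ha _ vsq).
    by rewrite normr_ge0.
  move=> k kj; apply: (sq_eigen_orth vsq (pm_eigen_sq sym (ha _ kj))).
  rewrite real_normK ?num_real//; apply/eqP => /eqP; rewrite eqf_sqr => /orP kE.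
  apply: nz; exists k.+1; first by rewrite /= (leqW kj).
  by case: kE => /eqP h; [left|right]; congr (_ %:C); move: h; lra.
have [lt0|lt0] := leP 0 (l - t).
  rewrite ger0_norm// in lte dlt; apply: sz; apply: he1.
    by apply/eqP => /complexI h; apply: nlE; left.
  rewrite -rmorphB normcR ger0_norm; lra.
rewrite ltr0_norm// in lte dlt; apply: sz; apply: he2.
  by apply/eqP => /complexI h; apply: nlE; right.
rewrite -rmorphB normcR ler0_norm; lra.
Qed.

Lemma gapquot_cases j : ((d j.+1)%:E < specgap A t j.+1)%E ->
  (exists D, [/\ specgap A t j.+1 = D%:E, d j.+1 < D &
     forall x, gapquot A t j.+1 x = x / (D ^+ 2 - d j.+1 ^+ 2)]) \/
  (specgap A t j.+1 = +oo%E /\ forall x, gapquot A t j.+1 x = 0).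
Proof.
rewrite /gapquot; case: (specgap A t j.+1) => [D||]//.
  rewrite lte_fin => dD; left; exists D; split=> // x.
  have d0 := specdist_ge0 j.+1.
  rewrite -EFin_expe -EFinB inver gt_eqF ?subr_gt0 ?ltr_pXn2r ?nnegrE//.
  by rewrite (le_trans d0)// ltW.
move=> _; right; split=> // x.
by rewrite expe2 mulyy addye// invey mule0.
Qed.

End SpectralGap.

(** * The inductive construction *)

Section Step.
Variables (R : realType) (H : completeNormedModType R[i]) (dot : {dot H for Num.conj}).
Hypothesis hdot : norm_induced_by dot.
Variable A : operator H.
Hypothesis sym : forall u v, dom A u -> dom A v -> dot (A u) v = dot u (A v).
Variables (t : R) (m : nat).
Hypothesis ne : testspace (dom A) m !=set0.
Local Notation d k := (specdist A t k).
Hypothesis hdisc : [set s%:C | s in `[t - d m, t + d m]]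
             `&` spectrum A `<=` disc_spectrum A.
Variables (j : 'I_m) (phi : 'I_m -> H).
Hypothesis ho : orthonormal_below dot j phi.
Hypothesis ha : adapted_below A t j phi.
Implicit Types (u v w e : H) (k i : 'I_m).

Local Notation B := (shift A t%:C).

Lemma phi_sq k : (k < j)%N -> sq_eigen dot A t (d k.+1) (phi k).
Proof. by move=> kj; apply: (pm_eigen_sq sym); exact: ha. Qed.

Lemma phi_dom k : (k < j)%N -> dom A (phi k).
Proof. by move=> /phi_sq[]. Qed.

Definition phi_proj v := \sum_(k < m | (k < j)%N) dot v (phi k) *: phi k.

Lemma phi_proj_dom v : dom A (phi_proj v).
Proof. by apply: dom_sum => k kj; apply: domZ; exact: phi_dom. Qed.

Lemma phi_proj_dot v k : (k < j)%N -> dot (phi_proj v) (phi k) = dot v (phi k).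
Proof.
move=> kj; rewrite dot_suml (bigD1 k)//= dotZl ho// eqxx mulr1 big1 ?addr0// => i.
by move=> /andP[ij ik]; rewrite dotZl ho// (negPf ik) mulr0.
Qed.

Lemma phi_proj_orth v w : (forall k, (k < j)%N -> dot w (phi k) = 0) ->
  dot (phi_proj v) w = 0.
Proof.
move=> wphi; rewrite dot_suml big1// => k kj.
by rewrite dotZl (dot_eq0C (wphi _ kj)) mulr0.
Qed.

Lemma phi_proj_shift_dot v x : dom A x -> dot (B (phi_proj v)) (B x) =
  \sum_(k < m | (k < j)%N) (d k.+1 ^+ 2)%:C * (dot v (phi k) * dot (phi k) x).
Proof.
move=> Dx; rewrite /phi_proj big_mkcond/= shift_sum; last first.
  by move=> k; case: ifP => [/phi_dom/domZ //|_]; exact: dom0.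
rewrite dot_suml [RHS]big_mkcond/=; apply: eq_bigr => k _.
case: ifP => kj; last by rewrite shift0 dot0l.
rewrite shiftZ; last exact: phi_dom.
by rewrite dotZl; case: (phi_sq kj) => _ ->//; rewrite mulrCA.
Qed.

Lemma phi_proj_norm v : rnorm (phi_proj v) ^+ 2 =
  \sum_(k < m | (k < j)%N) normc (dot v (phi k)) ^+ 2.
Proof.
apply: complexI; rewrite -(dotuu hdot) {1}/phi_proj dot_suml rmorph_sum/=.
apply: eq_bigr => k kj; rewrite dotZl dotC phi_proj_dot//.
exact: normc_conj.
Qed.

Lemma phi_proj_shift_norm v : rnorm (B (phi_proj v)) ^+ 2 =
  \sum_(k < m | (k < j)%N) d k.+1 ^+ 2 * normc (dot v (phi k)) ^+ 2.
Proof.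
apply: complexI; rewrite -(dotuu hdot) phi_proj_shift_dot; last exact: phi_proj_dom.
rewrite rmorph_sum/=; apply: eq_bigr => k kj.
by rewrite [dot (phi k) _](dotC dot) phi_proj_dot// normc_conj -rmorphM.
Qed.

(** The difference of the two sides is orthogonal to the earlier phi_i and still
    satisfies [sq_eigen] for d_k, since e pairs nontrivially only with those
    phi_i for which d_i = d_k; so [sq_eigen_exhausted] applies. *)
Lemma lower_eigenvector_in_span e k : eigenspace A (t + d k.+1)%:C e \/ eigenspace A (t - d k.+1)%:C e ->
  d k.+1 < d j.+1 -> e = phi_proj e.
Proof.
move=> Ee dkj.
have esq : sq_eigen dot A t (d k.+1) e.
  by case: Ee => Ee; apply: (eigen_sq_eigen sym Ee); ring.
apply/eqP; rewrite -subr_eq0; apply/eqP.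
apply: (sq_eigen_exhausted hdot sym ne ho ha (r := d k.+1)).
- by rewrite specdist_ge0.
- rewrite addrC -scaleN1r; apply: sq_eigenD => //; apply: sq_eigenZ.
  rewrite /phi_proj; apply: (big_ind (sq_eigen dot A t (d k.+1))).
  + by rewrite -[0](scale0r e); exact: sq_eigenZ.
  + by move=> x y; exact: sq_eigenD.
  move=> i ij; have [dd|dd] := eqVneq (d k.+1 ^+ 2) (d i.+1 ^+ 2).
    apply: sq_eigenZ; have [Di hi] := phi_sq ij.
    by split=> // x Dx; rewrite dd hi.
  by rewrite (sq_eigen_orth esq (phi_sq ij))// scale0r -(scale0r e); exact: sq_eigenZ.
- by move=> i ij; rewrite dotBl phi_proj_dot// subrr.
Qed.

(** The part y is orthogonal to phi_k: trivially if d_k differs from d_j, and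
    otherwise because phi_k is a sum of eigenvectors at t + d_j and t - d_j, to
    which v - phi_proj v - y is orthogonal. *)
Lemma splitting v : dom A v -> exists y w,
  [/\ v = (phi_proj v + w) + y, pm_eigen A t (d j.+1) y, dom A w,
      dot w y = 0 /\ orth dot (removed_eigenvectors A t j) w &
      forall k, (k < j)%N -> dot w (phi k) = 0 /\ dot y (phi k) = 0].
Proof.
move=> Dv; have d0 := @specdist_ge0 _ _ A t j.+1.
pose x := v - phi_proj v.
have xphi k : (k < j)%N -> dot x (phi k) = 0.
  by move=> kj; rewrite dotBl phi_proj_dot// subrr.
have iso l : l = t + d j.+1 \/ l = t - d j.+1 -> punctured_regular A l.
  move=> lE; apply: (near_punctured_regular hdot hdisc).
  by rewrite (dist_plus_minus d0 lE); exact: (specdist_le_last hdot t ne).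
have [y hy [wp wm]] := pm_eigen_split hdot sym x (iso _ (or_introl erefl)) (iso _ (or_intror erefl)).
pose w := x - y.
have ysq := pm_eigen_sq sym hy.
have w_pm u : pm_eigen A t (d j.+1) u -> dot w u = 0.
  by move=> [p [q [hp hq ->]]]; rewrite dotDr wp// wm// addr0.
have wphi k : (k < j)%N -> dot w (phi k) = 0.
  move=> kj; have [dd|dd] := eqVneq (d j.+1) (d k.+1).
    by apply: w_pm; rewrite dd; exact: ha.
  rewrite dotBl xphi// (sq_eigen_orth ysq (phi_sq kj)) ?subrr//.
  by rewrite eqrXn2 ?specdist_ge0.
exists y, w; split=> //.
- by rewrite /w /x -addrA subrK addrC subrK.
- by apply: domB; [apply: domB => //; exact: phi_proj_dom|case: ysq].
- split; first exact: w_pm.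
  move=> e [k [kj Ee]].
  have [dd|dd] := eqVneq (d k.+1) (d j.+1).
    by case: Ee; rewrite dd => Ee; [exact: wp|exact: wm].
  have dlt : d k.+1 < d j.+1 by rewrite lt_neqAle dd; apply: (specdist_mono hdot t ne).
  by rewrite (lower_eigenvector_in_span Ee dlt); apply: dot_eq0C; exact: phi_proj_orth.
- move=> k kj; split; first exact: wphi.
  by have := xphi k kj; rewrite -[x](subrK y) -/w dotDl wphi// add0r.
Qed.

(** The bounds b k are hypotheses here because they come from the residuals of
    the earlier steps; the rest of the step concerns v and the phi_k alone. *)
Lemma next_vector v F (eps : R) (b : 'I_m -> R) :
  dom A v -> rnorm v = 1 -> rnorm (B v) = F ->
  (forall k, (k < j)%N -> normc (dot v (phi k)) ^+ 2 <= b k) ->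
  0 <= eps < 1 ->
  gapquot A t j.+1 (F ^+ 2 - d j.+1 ^+ 2) + \sum_(k < m | (k < j)%N)
     b k * (1 + gapquot A t j.+1 (d j.+1 ^+ 2 - d k.+1 ^+ 2)) = eps ^+ 2 ->
  exists f, [/\ forall k, (k < j)%N -> dot f (phi k) = 0, dot f f = 1,
    pm_eigen A t (d j.+1) f, rnorm (v - dot v f *: f) <= eps &
    seminorm A t (v - dot v f *: f) <=
      Num.sqrt (F ^+ 2 - d j.+1 ^+ 2 + d j.+1 ^+ 2 * eps ^+ 2)].
Proof.
move=> Dv v1 vF vb /andP[eps0 eps1] epsE.
have [y [w [vE hy Dw [wy Mw] wyphi]]] := splitting Dv.
set s := phi_proj v in vE.
have [Dy ysq] := pm_eigen_sq sym hy.
have Ds : dom A s := phi_proj_dom v.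
have sw : dot s w = 0 by apply: phi_proj_orth => k /wyphi[].
have sy : dot s y = 0 by apply: phi_proj_orth => k /wyphi[].
have N1 : rnorm (s + w) ^+ 2 = rnorm s ^+ 2 + rnorm w ^+ 2 by exact: rnormD_sq.
have N2 : rnorm v ^+ 2 = rnorm (s + w) ^+ 2 + rnorm y ^+ 2.
  by rewrite {1}vE; apply: (rnormD_sq hdot); rewrite dotDl sy wy addr0.
have Bphi x : dom A x -> (forall k, (k < j)%N -> dot x (phi k) = 0) -> dot (B s) (B x) = 0.
  move=> Dx xphi; rewrite phi_proj_shift_dot// big1// => k kj.
  by rewrite (dot_eq0C (xphi _ kj)) !mulr0.
have B1 : rnorm (B (s + w)) ^+ 2 = rnorm (B s) ^+ 2 + rnorm (B w) ^+ 2.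
  by rewrite shiftD//; apply: (rnormD_sq hdot); apply: Bphi => // k /wyphi[].
have B2 : rnorm (B v) ^+ 2 = rnorm (B (s + w)) ^+ 2 + d j.+1 ^+ 2 * rnorm y ^+ 2.
  have -> : d j.+1 ^+ 2 * rnorm y ^+ 2 = rnorm (B y) ^+ 2.
    by apply: complexI; rewrite rmorphM/= -!(dotuu hdot) ysq.
  rewrite {1}vE shiftD//; last exact: domD.
  apply: (rnormD_sq hdot); apply: dot_eq0C; rewrite ysq; last exact: domD.
  by rewrite dotDr (dot_eq0C sy) (dot_eq0C wy) addr0 mulr0.
set c := fun k => normc (dot v (phi k)) ^+ 2.
have SE : rnorm s ^+ 2 = \sum_(k < m | (k < j)%N) c k := phi_proj_norm v.
have SBE : rnorm (B s) ^+ 2 = \sum_(k < m | (k < j)%N) d k.+1 ^+ 2 * c k :=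
  phi_proj_shift_norm v.
have main : rnorm (s + w) ^+ 2 <= eps ^+ 2.
  rewrite -epsE N1.
  case: (gapquot_cases (specdist_lt_specgap hdot sym ne hdisc ho ha)) => [[D [DE dD gq]]|[DE gq]].
    have d0 := @specdist_ge0 _ _ A t j.+1.
    have G : 0 < D ^+ 2 - d j.+1 ^+ 2.
      by rewrite subr_gt0 ltr_pXn2r ?nnegrE//; lra.
    have BW : D ^+ 2 * rnorm w ^+ 2 <= rnorm (B w) ^+ 2.
      have [->|w0] := eqVneq w 0; first by rewrite rnorm0 expr0n mulr0 sqr_ge0.
      have := specgap_bound hdot sym ne hdisc Dw Mw w0.
      rewrite DE lee_fin ler_pdivlMr ?rnorm_gt0// => h.
      rewrite -exprMn ler_pXn2r ?nnegrE ?rnorm_ge0//.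
      by rewrite mulr_ge0 ?rnorm_ge0//; lra.
    apply: (@le_trans _ _ (gapquot A t j.+1 (F ^+ 2 - d j.+1 ^+ 2) +
        \sum_(k < m | (k < j)%N)
          c k * (1 + gapquot A t j.+1 (d j.+1 ^+ 2 - d k.+1 ^+ 2)))).
      have -> : \sum_(k < m | (k < j)%N)
          c k * (1 + gapquot A t j.+1 (d j.+1 ^+ 2 - d k.+1 ^+ 2)) =
          rnorm s ^+ 2 + (d j.+1 ^+ 2 * rnorm s ^+ 2 - rnorm (B s) ^+ 2) /
            (D ^+ 2 - d j.+1 ^+ 2).
        rewrite SE SBE mulr_sumr -sumrB mulr_suml -big_split/=.
        by apply: eq_bigr => k _; rewrite gq; ring.
      rewrite gq addrCA lerD2l -mulrDl ler_pdivlMr//.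
      move: B2; rewrite vF B1 => ->.
      by move: N2; rewrite v1 N1; nra.
    rewrite lerD2l; apply: ler_sum => k kj; apply: ler_wpM2r; last exact: vb.
    rewrite gq addr_ge0// divr_ge0// ?(ltW G)// subr_ge0 ler_pXn2r ?nnegrE ?specdist_ge0//.
    by apply: (specdist_mono hdot t ne) => //; rewrite /= ltnS ltnW.
  have -> : w = 0.
    apply/eqP/negPn/negP => w0; have := specgap_bound hdot sym ne hdisc Dw Mw w0.
    by rewrite DE.
  rewrite rnorm0 expr0n addr0 gq add0r SE; apply: ler_sum => k kj.
  by rewrite gq addr0 mulr1; exact: vb.
have y0 : 0 < rnorm y.
  rewrite lt_neqAle rnorm_ge0 andbT eq_sym; apply/eqP => y0.
  by move: N2 main; rewrite v1 y0; nra.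
pose f := (rnorm y)^-1%:C *: y.
have vf : dot v f *: f = y.
  rewrite /f dotZr conj_real scalerA {1}vE !dotDl sy wy !add0r dotuu//.
  by rewrite -!rmorphM/= expr2 mulKf ?mulfV ?scale1r// gt_eqF.
have vyE : v - y = s + w by rewrite {1}vE addrK.
exists f; split.
- by move=> k /wyphi[_ h]; rewrite dotZl h mulr0.
- rewrite dotZl dotZr conj_real dotuu// -!rmorphM/= expr2 mulKf ?mulVf//.
    by rewrite gt_eqF.
  by rewrite gt_eqF.
- exact: pm_eigenZ.
- by rewrite vf vyE -(@ler_pXn2r _ 2%N)// ?nnegrE ?rnorm_ge0.
- rewrite vf vyE /seminorm -/(B (s + w)) -[X in X <= _](ger0_norm (rnorm_ge0 _)).
  rewrite -sqrtr_sqr ler_wsqrtr//.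
  have d2 := sqr_ge0 (d j.+1).
  move: N2 B2; rewrite v1 vF => N2 ->; nra.
Qed.

End Step.

Theorem proposition6 (R : realType) (H : completeNormedModType R[i])
  (dot : {dot H for Num.conj}) (hdot : norm_induced_by dot)
  (A : operator H) (hA : selfadjoint dot A)
  (n m : nat) (L : set H) (hL : has_dim L n) (hLA : L `<=` dom A)
  (t : R) (hm : (0 < m)%N) (hmn : (m <= n)%N)
  (hdisc : [set s%:C | s in `[t - specdist A t m, t + specdist A t m]]
             `&` spectrum A `<=` disc_spectrum A)
  (u : 'I_n -> H) (hu : orthonormal_family dot u)
  (hweak : forall j : 'I_n, weak_eigenpair dot A L t (minimax A t L j.+1) (u j))
  (eps : 'I_m -> R)
  (heps : forall j : 'I_m,
     eps j = Num.sqrt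
       (gapquot A t j.+1 (minimax A t L j.+1 ^+ 2 - specdist A t j.+1 ^+ 2)
        + \sum_(k < m | (k < j)%N)
            eps k ^+ 2 / (1 - eps k ^+ 2) *
            (1 + gapquot A t j.+1
                   (specdist A t j.+1 ^+ 2 - specdist A t k.+1 ^+ 2))))
  (heps01 : forall j : 'I_m, 0 < eps j < 1) :
  exists phi : 'I_m -> H,
    [/\ orthonormal_family dot phi,
        forall j, eigensum A `[t - specdist A t m, t + specdist A t m] (phi j)
      & forall j : 'I_m,
          let r := u (widen_ord hmn j)
                   - dot (u (widen_ord hmn j)) (phi j) *: phi j in
          [/\ eigensum A [set t - specdist A t j.+1; t + specdist A t j.+1]
                (phi j),
              rnorm r <= eps j
            & seminorm A t r <=
              Num.sqrt (minimax A t L j.+1 ^+ 2 - specdist A t j.+1 ^+ 2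
                        + specdist A t j.+1 ^+ 2 * eps j ^+ 2)]].
Proof.
have sym v w : dom A v -> dom A w -> dot (A v) w = dot v (A w).
  by move=> Dv Dw; apply: (hA.2 w (A w)).1.
have ne : testspace (dom A) m !=set0.
  by have [|V hV _] := @testspace_widen _ _ (dom A) m n L hmn; [|exists V].
pose U j := u (widen_ord hmn j).
have U_L j : L (U j) by case: (hweak (widen_ord hmn j)).
have U_D j : dom A (U j) by apply: hLA.
have UU i k : dot (U i) (U k) = (i == k)%:R by rewrite hu.
have U1 j : rnorm (U j) = 1.
  have := UU j j; rewrite eqxx dotuu// => /complexI /eqP.
  by rewrite sqrp_eq1 ?rnorm_ge0// => /eqP.
have UF j : rnorm (shift A t%:C (U j)) = minimax A t L j.+1.
  have [F0 _ _ /(_ _ (U_L j))] := hweak (widen_ord hmn j).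
  rewrite -/(U j) -/(shift A _ _) !dotuu// -rmorphM/= U1 expr1n mulr1 => /complexI /eqP.
  by rewrite eqrXn2 ?rnorm_ge0// => /eqP.
pose res phi (k : 'I_m) := U k - dot (U k) (phi k) *: phi k.
pose good phi (k : 'I_m) := rnorm (res phi k) <= eps k /\
  seminorm A t (res phi k) <= Num.sqrt (minimax A t L k.+1 ^+ 2
     - specdist A t k.+1 ^+ 2 + specdist A t k.+1 ^+ 2 * eps k ^+ 2).
have ind J : (J <= m)%N -> exists phi : 'I_m -> H, [/\
    forall i k : 'I_m, (i < J)%N -> (k < J)%N -> dot (phi i) (phi k) = (i == k)%:R,
    forall k : 'I_m, (k < J)%N -> pm_eigen A t (specdist A t k.+1) (phi k) &
    forall k : 'I_m, (k < J)%N -> good phi k].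
  elim: J => [_|J IH JM]; first by exists (fun=> 0).
  have [phi [ho ha hg]] := IH (ltnW JM).
  pose j := Ordinal JM.
  have e2 k : 0 < 1 - eps k ^+ 2.
    by have /andP[e0 e1] := heps01 k; rewrite subr_gt0 expr_lt1// ltW.
  (* 0 = <u_j, u_k> = conj a <u_j, phi_k> + <u_j, res_k> with a = <u_k, phi_k>
     and |a| ^ 2 >= 1 - eps_k ^ 2 *)
  have vb (k : 'I_m) : (k < j)%N -> normc (dot (U j) (phi k)) ^+ 2 <= eps k ^+ 2 / (1 - eps k ^+ 2).
    move=> kj; have [gk _] := hg k kj.
    set a := dot (U k) (phi k).
    have pp : dot (phi k) (phi k) = 1 by rewrite ho// eqxx.
    have rp : dot (res phi k) (phi k) = 0 by rewrite dotBl dotZl pp mulr1 subrr.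
    have p1 : rnorm (phi k) ^+ 2 = 1.
      by apply: complexI; rewrite -(dotuu hdot) pp.
    have Na : normc a ^+ 2 = 1 - rnorm (res phi k) ^+ 2.
      have : rnorm (U k) ^+ 2 = rnorm (res phi k) ^+ 2 + rnorm (a *: phi k) ^+ 2.
        rewrite -(rnormD_sq hdot) ?subrK//.
        by apply: dot_eq0C; rewrite dotZl (dot_eq0C rp) mulr0.
      by rewrite U1 rnormZ exprMn p1; lra.
    have : a^* * dot (U j) (phi k) = - dot (U j) (res phi k).
      apply/eqP; rewrite -subr_eq0 opprK -dotZr -dotDr addrC subrK UU.
      have jk : (j == k) = false by rewrite -val_eqE/= gtn_eqF.
      by rewrite jk.
    move=> /(congr1 (@normc R)); rewrite normcN normcM => h.
    have /= h2 := normc_dot_le hdot (U j) (res phi k).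
    rewrite U1 mul1r -h in h2.
    have ca : normc a^* = normc a by case: (a) => x y /=; rewrite sqrrN.
    rewrite ca in h2.
    rewrite ler_pdivlMr//.
    have r0 := rnorm_ge0 (res phi k).
    have e0 : 0 <= eps k by have /andP[/ltW] := heps01 k.
    have c0 := normc_ge0 (dot (U j) (phi k)).
    apply: (@le_trans _ _ (normc (dot (U j) (phi k)) ^+ 2 * normc a ^+ 2)).
      apply: ler_wpM2l; first exact: sqr_ge0.
      by rewrite Na lerD2l lerN2 ler_pXn2r ?nnegrE.
    rewrite -exprMn ler_pXn2r ?nnegrE ?mulr_ge0 ?normc_ge0// mulrC.
    exact: le_trans h2 gk.
  have e01 : 0 <= eps j < 1 by have /andP[/ltW -> ->] := heps01 j.
  have epsE : gapquot A t j.+1 (minimax A t L j.+1 ^+ 2 - specdist A t j.+1 ^+ 2) +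
      \sum_(k < m | (k < j)%N) eps k ^+ 2 / (1 - eps k ^+ 2) *
      (1 + gapquot A t j.+1 (specdist A t j.+1 ^+ 2 - specdist A t k.+1 ^+ 2)) = eps j ^+ 2.
    rewrite [in RHS]heps sqr_sqrtr//; have /andP[] := heps01 j.
    by rewrite heps sqrtr_gt0 => /ltW.
  have [f [fphi f1 fpm fr fs]] := next_vector (j := j) hdot sym ne hdisc ho ha
     (U_D j) (U1 j) (UF j) vb e01 epsE.
  pose phi' k := if k == j then f else phi k.
  have phi'j : phi' j = f by rewrite /phi' eqxx.
  have phi'k (k : 'I_m) : (k < J)%N -> phi' k = phi k.
    by move=> kJ; rewrite /phi' -val_eqE/= ltn_eqF.
  have splitJ (k : 'I_m) : (k < J.+1)%N -> k = j \/ (k < J)%N.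
    rewrite ltnS leq_eqVlt => /orP[/eqP kJ|]; last by right.
    by left; exact: val_inj.
  exists phi'; split.
  - move=> i k /splitJ[->|iJ] /splitJ[->|kJ].
    + by rewrite phi'j f1 eqxx.
    + by rewrite phi'j phi'k// fphi// -val_eqE/= gtn_eqF.
    + by rewrite phi'j phi'k// (dot_eq0C (fphi _ _))// -val_eqE/= ltn_eqF.
    + by rewrite !phi'k// ho.
  - by move=> k /splitJ[->|kJ]; [rewrite phi'j|rewrite phi'k//; exact: ha].
  - move=> k /splitJ[->|kJ]; rewrite /good /res.
      by rewrite phi'j.
    by rewrite phi'k//; exact: hg.
have [phi [ho ha hg]] := ind m (leqnn m).
exists phi; split.
- by move=> i k; exact: ho.
- move=> j; have d0 := @specdist_ge0 _ _ A t j.+1; have dm := specdist_le_last hdot t ne j.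
  by apply: pm_eigen_sum (ha j (ltn_ord j)); rewrite /= in_itv/=; lra.
- move=> j r; have [h1 h2] := hg j (ltn_ord j); split=> //.
  by apply: pm_eigen_sum (ha j (ltn_ord j)); [right|left].
Qed.
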